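(* Assume $\sum_{k=0}^Na_k^2>0$, let $0<\varepsilon<\min_{1\le s\le N}(r_s-r_{s-1})$, $T=1+\varepsilon$, and $(y,x_0)\in\widehat{M}^2$. Set $d^2=1+\sum_{k=1}^Nd_k^2$ and $\hat a=\big(d^{-2}\sum_{k=0}^Na_k^2\big)^{1/2}>0$. Then the problem $\|u\|_{L^2(0,T)}\to\min$, $u\in\mathcal{U}_T(y,x_0)$, has a unique solution $\widehat u$. It is the function $$\widehat u(t)=\begin{cases}\widehat u_0(t), & t\in[0,\varepsilon),\\ \sum_{k=s}^N\big[d_k\dot x_0(t-r_k)-a_kx_0(t-r_k)\big], & t\in[r_{s-1}+\varepsilon,r_s),\ s=1,\dots,N,\\ \varphi_s(t-r_s)+d_s\widehat u_0(t-r_s)+(d_sa_0-a_s)\int_0^{t-r_s}e^{a_0(t-r_s-\tau)}\widehat u_0(\tau)\,d\tau, & t\in[r_s,r_s+\varepsilon),\ s=1,\dots,N,\end{cases}$$ with $$\widehat u_0(t)=d^{-2}\Big[\sum_{s=1}^N\int_0^t\Big((d_sa_0-a_s)\cosh(\hat a(t-\tau))+\Big(\frac{a_sa_0}{\hat a}-d_s\hat a\Big)\sinh(\hat a(t-\tau))\Big)\varphi_s(\tau)\,d\tau-\sum_{s=1}^Nd_s\varphi_s(t)+c\Big(\cosh(\hat at)-\frac{a_0}{\hat a}\sinh(\hat at)\Big)\Big],$$ $$c=\frac{1}{\sinh(\hat a\varepsilon)}\Big(-d^2\hat a\,\widetilde{x}(\varepsilon)+\int_0^\varepsilon\sum_{s=1}^N\big(\hat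 ad_s\cosh(\hat a(\varepsilon-\tau))+a_s\sinh(\hat a(\varepsilon-\tau))\big)\varphi_s(\tau)\,d\tau\Big).$$
   Context: Fix $N\ge1$, delays $0=r_0<r_1<\dots<r_N=1$, and real coefficients $d_1,\dots,d_N$, $a_0,\dots,a_N$ with $d_N^2+a_N^2\ne0$. Consider the scalar control equation $\dot x(t)+\sum_{k=1}^Nd_k\dot x(t-r_k)=\sum_{k=0}^Na_kx(t-r_k)+u(t)$, $t\ge0$, with control $u\in L^2_{loc}(0,\infty)$ and initial data $x(0)=y$, $x(t)=x_0(t)$ for $t\in[-1,0)$, where $(y,x_0)\in\widehat{M}^2=\{(y,x_0):x_0\in W^{1,2}(-1,0),\ y=x_0(0)\}$. For every such state and control there is a unique continuous solution $x(t;y,x_0,u)$. For $T>1$, $\mathcal{U}_T(y,x_0)$ is the set of $u\in L^2(0,T)$ with $x(t;y,x_0,u)=0$ for all $t\in[T-1,T]$. For $\sigma\in[0,\varepsilon]$ define $\widetilde{x}(\sigma)=e^{a_0\sigma}\big(y+\int_0^\sigma e^{-a_0\tau}\sum_{k=1}^N[a_kx_0(\tau-r_k)-d_k\dot x_0(\tau-r_k)]d\tau\big)$ and, for $s=1,\dots,N$, $\varphi_s(\sigma)=(d_sa_0-a_s)\widetilde{x}(\sigma)+\sum_{k=s+1}^N[d_k\dot x_0(\sigma+r_s-r_k)-a_kx_0(\sigma+r_s-r_k)]-d_s\sum_{k=1}^N[d_k\dot x_0(\sigma-r_k)-a_kx_0(\sigma-r_k)]$. *)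

(* Defs.v *)
From HB Require Import structures.
From mathcomp Require Import all_boot all_order all_algebra.
From mathcomp Require Import all_classical all_reals all_analysis.
Set Implicit Arguments. Unset Strict Implicit. Unset Printing Implicit Defensive.
Import Order.TTheory GRing.Theory Num.Theory.
Import numFieldNormedType.Exports.
Local Open Scope classical_set_scope.
Local Open Scope ring_scope.

Section Defs.
Variable R : realType.

Definition coshR (x : R) : R := (expR x + expR (- x)) / 2.
Definition sinhR (x : R) : R := (expR x - expR (- x)) / 2.

Definition integ (a b : R) (f : R -> R) : R :=
  \int[@lebesgue_measure R]_(x in `[a, b]) f x.

Definition L2on (a b : R) (f : R -> R) : Prop :=
  measurable_fun `[a, b] f /\
  (\int[@lebesgue_measure R]_(x in `[a, b]) ((f x) ^+ 2)%:E < +oo)%E.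

Definition L2norm (a b : R) (f : R -> R) : R :=
  Num.sqrt (integ a b (fun x => (f x) ^+ 2)).

(* x0 in W^{1,2}(-1,0) (absolutely continuous representative) with
   (weak) derivative dx0 in L^2(-1,0) *)
Definition W12 (x0 dx0 : R -> R) : Prop :=
  L2on (-1) 0 dx0 /\
  forall t, -1 <= t <= 0 -> x0 t = x0 (-1) + integ (-1) t dx0.

(* x is a (continuous) solution on [-1,T] of
   x'(t) + sum_{k=1}^N d_k x'(t-r_k) = sum_{k=0}^N a_k x(t-r_k) + u(t),
   x(0) = y, x = x0 on [-1,0), in integrated form. *)
Definition is_solution (N : nat) (r d a : nat -> R) (y : R) (x0 u : R -> R)
    (T : R) (x : R -> R) : Prop :=
  {within `[-1, T], continuous x} /\
  (forall t, -1 <= t < 0 -> x t = x0 t) /\ x 0 = y /\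
  forall t, 0 <= t <= T ->
    x t + \sum_(1 <= k < N.+1) d k * x (t - r k) =
    y + \sum_(1 <= k < N.+1) d k * x (- r k) +
    integ 0 t (fun tau => \sum_(0 <= k < N.+1) a k * x (tau - r k) + u tau).

Definition admissible (N : nat) (r d a : nat -> R) (y : R) (x0 : R -> R)
    (T : R) (u : R -> R) : Prop :=
  L2on 0 T u /\
  exists x, is_solution N r d a y x0 u T x /\
            forall t, T - 1 <= t <= T -> x t = 0.

Section Formulas.
Variables (N : nat) (r d a : nat -> R) (y : R) (x0 dx0 : R -> R) (eps : R).

Definition dsq : R := 1 + \sum_(1 <= k < N.+1) d k ^+ 2.
Definition ahat : R := Num.sqrt (dsq^-1 * \sum_(0 <= k < N.+1) a k ^+ 2).

Definition xtilde (sigma : R) : R :=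
  expR (a 0%N * sigma) *
  (y + integ 0 sigma (fun tau => expR (- (a 0%N * tau)) *
        \sum_(1 <= k < N.+1) (a k * x0 (tau - r k) - d k * dx0 (tau - r k)))).

Definition phi (s : nat) (sigma : R) : R :=
  (d s * a 0%N - a s) * xtilde sigma
  + \sum_(s.+1 <= k < N.+1)
      (d k * dx0 (sigma + r s - r k) - a k * x0 (sigma + r s - r k))
  - d s * \sum_(1 <= k < N.+1) (d k * dx0 (sigma - r k) - a k * x0 (sigma - r k)).

Definition cconst : R :=
  (sinhR (ahat * eps))^-1 *
  (- (dsq * ahat * xtilde eps) +
   integ 0 eps (fun tau => \sum_(1 <= s < N.+1)
      (ahat * d s * coshR (ahat * (eps - tau)) + a s * sinhR (ahat * (eps - tau)))
      * phi s tau)).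

Definition uhat0 (t : R) : R :=
  dsq^-1 *
  (\sum_(1 <= s < N.+1)
      integ 0 t (fun tau =>
        ((d s * a 0%N - a s) * coshR (ahat * (t - tau)) +
         (a s * a 0%N / ahat - d s * ahat) * sinhR (ahat * (t - tau))) * phi s tau)
   - \sum_(1 <= s < N.+1) d s * phi s t
   + cconst * (coshR (ahat * t) - a 0%N / ahat * sinhR (ahat * t))).

Definition ind (lo hi t : R) : R := if (lo <= t) && (t < hi) then 1 else 0.

Definition uhat (t : R) : R :=
  ind 0 eps t * uhat0 t +
  \sum_(1 <= s < N.+1)
    (ind (r s.-1 + eps) (r s) t *
       \sum_(s <= k < N.+1) (d k * dx0 (t - r k) - a k * x0 (t - r k))
     + ind (r s) (r s + eps) t *
       (phi s (t - r s) + d s * uhat0 (t - r s)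
        + (d s * a 0%N - a s) *
          integ 0 (t - r s) (fun tau => expR (a 0%N * (t - r s - tau)) * uhat0 tau))).

End Formulas.
End Defs.

(* Main.v *)
(* The condition x = 0 on [eps, T] turns the control into a function of the state
   X on [0, eps): with d_0 = 1, u(t) = sum_k (d_k X'(t - r_k) - a_k X(t - r_k)),
   where X = x0 on [-1, 0) and X = 0 on [eps, T].  Writing X = xtilde + w on [0, eps],
   the squared norm of u becomes a quadratic functional of w and w' with
   w(0) = 0, w(eps) = - xtilde(eps), up to a constant.  Its Euler-Lagrange equation is
   a linear system with frequency ahat, and hyperbolic convolutions with the phi_s
   solve it; this is the formula for uhat0.  For any other admissible u the difference
   of the states vanishes at 0 and eps, so an integration by parts against the
   Euler-Lagrange equation gives that u - uhat is orthogonal to uhat, and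
   ||u||^2 = ||uhat||^2 + ||u - uhat||^2. *)
Require Import Defs.
From HB Require Import structures.
From mathcomp Require Import all_boot all_order all_algebra.
From mathcomp Require Import all_classical all_reals all_analysis.
From mathcomp Require Import measurable_realfun.
From mathcomp Require Import zify ring lra.
Import Order.TTheory GRing.Theory Num.Theory.
Import numFieldNormedType.Exports.
Local Open Scope classical_set_scope.
Local Open Scope ring_scope.

(** * L^2 functions on intervals and absolutely continuous functions *)

(** Regularity is the obstacle: [dx0], and with it each [phi s] and every piece of [uhat], is only
    in L^2, and a competing trajectory is only continuous and solves the equation in integrated
    form. So a derivative is always an L^2 function whose primitive is the function at hand ([ac2]),
    and the product rule comes from Fubini. The Euler-Lagrange equation makes sense in this setting
    because the rough terms cancel in the momentum, the sum of the [lead k * lq_output k], which is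
    absolutely continuous although its summands need not be. The bound on [eps] makes the windows
    [r_k, r_k + eps) disjoint, so at each time at most one delayed argument lies in [0, eps).
    Shifting every window back to [0, eps) leaves a variational problem without delays for one
    scalar function W. Its equation has the form W'' = (d^-2 sum a_k^2) W + data, whence the
    frequency [ahat]. The constant c is the initial momentum; the end condition W(eps) = -
    xtilde(eps) is linear in c and is solvable because sinh(ahat eps) > 0. *)

Section L2.
Set Implicit Arguments.
Unset Strict Implicit.
Context {R : realType}.
Implicit Types (a b c t : R) (f g h F G : R -> R).
Local Notation mu := (@lebesgue_measure R).
Local Notation L1on a b f := (mu.-integrable `[a, b] (EFin \o f)).

Lemma L2onP a b f :
  L2on a b f <-> measurable_fun `[a, b] f /\ L1on a b (fun x => f x ^+ 2).
Proof.
split=> -[mf If]; split=> //.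
- apply/integrableP; split.
    by apply/measurable_EFinP; exact: measurable_funX.
  under eq_integral do rewrite /= ger0_norm ?sqr_ge0//.
  exact: If.
- move/integrableP : If => [_].
  by under eq_integral do rewrite /= ger0_norm ?sqr_ge0//.
Qed.

Lemma L1on_le a b f g : measurable_fun `[a, b] f -> L1on a b g ->
  (forall x, a <= x <= b -> `|f x| <= g x) -> L1on a b f.
Proof.
move=> mf ig fg; apply: le_integrable ig => //; first exact/measurable_EFinP.
move=> x /=; rewrite in_itv /= => xab; rewrite lee_fin.
by rewrite (le_trans (fg x xab))// ler_norm.
Qed.

Lemma L2on_le a b f g : measurable_fun `[a, b] f -> L1on a b g ->
  (forall x, a <= x <= b -> f x ^+ 2 <= g x) -> L2on a b f.
Proof.
move=> mf ig fg; apply/L2onP; split => //; apply: L1on_le ig _.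
  exact: measurable_funX.
by move=> x xab; rewrite ger0_norm ?sqr_ge0 ?fg.
Qed.

Lemma L1onD a b f g : L1on a b f -> L1on a b g ->
  L1on a b (fun x => f x + g x).
Proof. by move=> fi gi; exact: (integrableD _ fi gi). Qed.

Lemma L1onZ a b k f : L1on a b f -> L1on a b (fun x => k * f x).
Proof. by move=> fi; exact: (integrableZl _ _ fi). Qed.

Lemma L1on_cst a b k : L1on a b (fun=> k).
Proof.
apply: measurable_bounded_integrable => //=.
- by rewrite lebesgue_measure_itv /=; case: ifP => // _; exact: ltry.
- exists `|k|; split; first exact: num_real.
  by move=> x kx y _; apply: ltW.
Qed.

Lemma L2on_L1onM a b f g : L2on a b f -> L2on a b g ->
  L1on a b (fun x => f x * g x).
Proof.
move=> /L2onP[mf If] /L2onP[mg Ig].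
apply: (L1on_le _ (L1onD If Ig)); first exact: measurable_funM.
move=> x _; rewrite ler_norml; apply/andP; split; nra.
Qed.

Lemma L2on_L1on {a b f} : L2on a b f -> L1on a b f.
Proof.
move=> /L2onP[mf If].
apply: (L1on_le mf (L1onD (L1on_cst a b 1) If)).
move=> x _; rewrite ler_norml; apply/andP; split; nra.
Qed.

Lemma L2onD a b f g : L2on a b f -> L2on a b g -> L2on a b (fun x => f x + g x).
Proof.
move=> /L2onP[mf If] /L2onP[mg Ig].
apply: (@L2on_le _ _ _ (fun x => 2 * (f x ^+ 2 + g x ^+ 2))).
- exact: measurable_funD.
- by apply: L1onZ; exact: L1onD.
- by move=> x _; have := sqr_ge0 (f x - g x); nra.
Qed.

Lemma L2onM a b M f g : measurable_fun `[a, b] g ->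
  (forall x, a <= x <= b -> `|g x| <= M) ->
  L2on a b f -> L2on a b (fun x => g x * f x).
Proof.
move=> mg gM /L2onP[mf If].
apply: (@L2on_le _ _ _ (fun x => M ^+ 2 * (f x ^+ 2))).
- exact: measurable_funM.
- exact: L1onZ.
- move=> x xab; rewrite exprMn ler_wpM2r ?sqr_ge0//.
  by rewrite -(real_normK (num_real (g x))) lerXn2r ?nnegrE ?gM// (le_trans _ (gM x xab)).
Qed.

Lemma L2on_cst a b k : L2on a b (fun=> k).
Proof. by apply/L2onP; split=> //; exact: (L1on_cst _ _ (k ^+ 2)). Qed.

Lemma L2onZ a b k f : L2on a b f -> L2on a b (fun x => k * f x).
Proof. by apply: (@L2onM a b `|k| f (fun=> k)). Qed.

Lemma L2onN a b f : L2on a b f -> L2on a b (fun x => - f x).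
Proof. by move=> /(L2onZ (-1)); under eq_fun do rewrite mulN1r. Qed.

Lemma L2onB a b f g : L2on a b f -> L2on a b g -> L2on a b (fun x => f x - g x).
Proof. by move=> fi /L2onN; exact: L2onD. Qed.

Lemma L2on_sum a b m n (f : nat -> R -> R) :
  (forall k, (m <= k < n)%N -> L2on a b (f k)) ->
  L2on a b (fun x => \sum_(m <= k < n) f k x).
Proof.
elim: n => [|n IH] fi.
  by under eq_fun do rewrite big_geq//; exact: L2on_cst.
have [mn|nm] := leqP m n; last first.
  by under eq_fun do rewrite big_geq//; exact: L2on_cst.
under eq_fun do rewrite big_nat_recr//=.
apply: L2onD; last by apply: fi; rewrite mn ltnSn.
by apply: IH => k /andP[mk kn]; apply: fi; rewrite mk ltnS ltnW.
Qed.

Lemma continuous_within_bounded a b g : {within `[a, b], continuous g} ->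
  exists M, forall x, a <= x <= b -> `|g x| <= M.
Proof.
move=> cg; have [ab|ba] := leP a b; last first.
  by exists 0 => x /andP[ax xb]; have := lt_le_trans ba (le_trans ax xb); rewrite ltxx.
have [c1 _ h1] := EVT_max ab cg.
have [c2 _ h2] := EVT_min ab cg.
exists (`|g c1| + `|g c2|) => x xab.
have {}h1 := h1 x; have {}h2 := h2 x; rewrite !in_itv/= in h1 h2.
have n1 := normr_ge0 (g c1); have n2 := normr_ge0 (g c2).
have p1 := ler_norm (g c1); have p2 := ler_norm (- g c2); rewrite normrN in p2.
by rewrite ler_norml; apply/andP; split; have := h1 xab; have := h2 xab; lra.
Qed.

Lemma continuous_within_measurable a b g : {within `[a, b], continuous g} ->
  measurable_fun `[a, b] g.
Proof. by move=> cg; apply: subspace_continuous_measurable_fun. Qed.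

Lemma L2on_continuousM a b f g : {within `[a, b], continuous g} ->
  L2on a b f -> L2on a b (fun x => g x * f x).
Proof.
move=> cg; have [M gM] := continuous_within_bounded cg.
by apply: (L2onM _ gM); exact: continuous_within_measurable.
Qed.

Lemma L2on_continuous a b g : {within `[a, b], continuous g} -> L2on a b g.
Proof.
move=> cg; have := L2on_continuousM cg (@L2on_cst a b 1).
by under eq_fun do rewrite mulr1.
Qed.

(** * Restriction to subintervals, irrelevance of endpoints, gluing *)

Lemma mem_itvcc a b t : (t \in `[a, b]%classic) = (a <= t <= b).
Proof. by apply/idP/idP; rewrite inE/= in_itv/=. Qed.

Lemma subset_itvcc a b a' b' : a <= a' -> b' <= b -> `[a', b'] `<=` `[a, b].
Proof. by move=> aa bb; apply: subset_itv; rewrite bnd_simp. Qed.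

Lemma L1onS {a b a' b' f} : a <= a' -> b' <= b -> L1on a b f -> L1on a' b' f.
Proof.
by move=> aa bb; apply: integrableS => //; exact: subset_itvcc.
Qed.

Lemma L2onS {a b a' b' f} : a <= a' -> b' <= b -> L2on a b f -> L2on a' b' f.
Proof.
move=> aa bb /L2onP[mf If]; apply/L2onP; split; last exact: L1onS If.
by apply: measurable_funS mf => //; exact: subset_itvcc.
Qed.

Lemma measurable_oo_cc a b f : measurable_fun `]a, b[ f -> measurable_fun `[a, b] f.
Proof.
move=> mf; have [ab|ba] := ltP a b; last first.
  apply: (@measurable_funS _ _ _ _ [set a]) => //; last exact: measurable_fun_set1.
  move=> x /=; rewrite in_itv/= => /andP[ax xb]; apply/eqP.
  by rewrite eq_le ax (le_trans xb ba).
have -> : `[a, b]%classic = [set a] `|` (`]a, b[ `|` [set b]).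
  by rewrite setUitv1 ?setU1itv// bnd_simp// ltW.
apply/measurable_funU => //; first exact: measurableU.
split; first exact: measurable_fun_set1.
apply/measurable_funU => //; split; [exact: mf|exact: measurable_fun_set1].
Qed.

(** Endpoints form a null set, so equality on the open interval suffices. This lets functions
    defined by cases be compared without looking at their breakpoints. *)
Lemma L1on_ext a b f g : (forall x, a < x < b -> f x = g x) -> L1on a b f -> L1on a b g.
Proof.
move=> fg If.
have mf : measurable_fun `]a, b[ f.
  have /measurable_EFinP mf := measurable_int mu If.
  by apply: measurable_funS mf => //; exact: subset_itv_oo_cc.
have mg : measurable_fun `]a, b[ g.
  by apply: eq_measurable_fun mf => x; rewrite inE/= in_itv/= => /fg.
apply/integrableP; split; first by apply/measurable_EFinP; exact: measurable_oo_cc.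
rewrite (@integral_itv_bndoo _ _ _ _ true false); last first.
  by apply: measurableT_comp => //; apply/measurable_EFinP.
have /integrableP[_] := If.
rewrite (@integral_itv_bndoo _ _ _ _ true false); last first.
  by apply: measurableT_comp => //; apply/measurable_EFinP.
apply: le_lt_trans; rewrite le_eqVlt; apply/orP; left; apply/eqP.
by apply: eq_integral => x; rewrite inE/= in_itv/= => /fg ->.
Qed.

Lemma L2on_ext a b f g : (forall x, a < x < b -> f x = g x) -> L2on a b f -> L2on a b g.
Proof.
move=> fg /L2onP[mf If]; apply/L2onP; split; last first.
  by apply: L1on_ext If => x /fg ->.
apply: measurable_oo_cc; apply: (eq_measurable_fun f).
  by move=> x; rewrite inE/= in_itv/= => /fg.
by apply: measurable_funS mf => //; exact: subset_itv_oo_cc.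
Qed.

Lemma integ_ext {a b} f g : (forall x, a < x < b -> f x = g x) -> L1on a b f ->
  integ a b f = integ a b g.
Proof.
move=> fg If; have Ig := L1on_ext fg If.
rewrite /integ /Rintegral.
have mo h : L1on a b h -> measurable_fun `]a, b[ (EFin \o h).
  move=> Ih; apply: measurable_funS (measurable_int mu Ih) => //.
  exact: subset_itv_oo_cc.
rewrite !(@integral_itv_bndoo _ _ _ _ true false); [|exact: mo|exact: mo].
congr fine; apply: eq_integral => x; rewrite inE/= in_itv/= => /fg -> //.
Qed.

Lemma eq_integ {a b} f g : (forall x, a <= x <= b -> f x = g x) ->
  integ a b f = integ a b g.
Proof.
move=> fg; apply: eq_Rintegral => x; rewrite inE/= in_itv/=; exact: fg.
Qed.

Lemma itvcc_cat a b c : a <= b -> b <= c -> `[a, c]%classic = `[a, b] `|` `]b, c].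
Proof.
by move=> ab bc; apply: itv_bndbnd_setU; rewrite bnd_simp.
Qed.

Lemma integ_cat {a b c} f : a <= b -> b <= c -> L1on a c f ->
  integ a c f = integ a b f + integ b c f.
Proof.
move=> ab bc If; rewrite /integ (itvcc_cat ab bc) Rintegral_setU//=.
- congr (_ + _); rewrite -[RHS]Rintegral_itv_obnd_cbnd//.
  apply: integrableS If => //; apply: subset_itv; by rewrite bnd_simp.
- by rewrite -itvcc_cat.
- apply/disj_setPS => y [/=]; rewrite 2!in_itv/= => /andP[_ yx] /andP[].
  by rewrite ltNge yx.
Qed.

Lemma L2on_cat a b c f : a <= b -> b <= c -> L2on a b f -> L2on b c f -> L2on a c f.
Proof.
move=> ab bc [mf If] [mg Ig].
have bcs : `]b, c] `<=` `[b, c] by apply: subset_itv; rewrite bnd_simp.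
have m1 : measurable_fun `[a, c] f.
  rewrite (itvcc_cat ab bc); apply/measurable_funU => //; split => //.
  exact: measurable_funS mg.
split=> //; rewrite (itvcc_cat ab bc) ge0_integral_setU//=; first 1 last.
- rewrite -itvcc_cat//; apply/measurable_EFinP; exact: measurable_funX.
- by move=> x _; rewrite lee_fin sqr_ge0.
- apply/disj_setPS => y [/=]; rewrite 2!in_itv/= => /andP[_ yx] /andP[].
  by rewrite ltNge yx.
apply: lte_add_pinfty => //; apply: le_lt_trans Ig.
apply: ge0_subset_integral => //.
  by apply/measurable_EFinP; exact: measurable_funX.
by move=> x _; rewrite lee_fin sqr_ge0.
Qed.

Lemma integ1 a f : integ a a f = 0.
Proof. by rewrite /integ set_itv1 Rintegral_set1. Qed.

Lemma integD {a b} f g : L1on a b f -> L1on a b g ->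
  integ a b (fun x => f x + g x) = integ a b f + integ a b g.
Proof. by move=> fi gi; exact: RintegralD. Qed.

Lemma integB {a b} f g : L1on a b f -> L1on a b g ->
  integ a b (fun x => f x - g x) = integ a b f - integ a b g.
Proof. by move=> fi gi; exact: RintegralB. Qed.

Lemma integZ {a b} k f : L1on a b f -> integ a b (fun x => k * f x) = k * integ a b f.
Proof. by move=> fi; exact: RintegralZl. Qed.

Lemma integ_cst0 a b : integ a b (fun=> 0) = 0.
Proof. by rewrite /integ Rintegral_cst// mul0r. Qed.

Lemma L1on_sum a b m n (f : nat -> R -> R) :
  (forall k, (m <= k < n)%N -> L1on a b (f k)) ->
  L1on a b (fun x => \sum_(m <= k < n) f k x).
Proof.
elim: n => [|n IH] fi.
  by under [X in EFin \o X]eq_fun do rewrite big_geq//; exact: L1on_cst.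
have [mn|nm] := leqP m n; last first.
  by under [X in EFin \o X]eq_fun do rewrite big_geq//; exact: L1on_cst.
under [X in EFin \o X]eq_fun do rewrite big_nat_recr//=.
apply: L1onD; last by apply: fi; rewrite mn ltnSn.
by apply: IH => k /andP[mk kn]; apply: fi; rewrite mk ltnS ltnW.
Qed.

Lemma integ_sum {a b} m n (f : nat -> R -> R) :
  (forall k, (m <= k < n)%N -> L1on a b (f k)) ->
  integ a b (fun x => \sum_(m <= k < n) f k x) = \sum_(m <= k < n) integ a b (f k).
Proof.
elim: n => [|n IH] fi.
  rewrite big_geq// -[RHS](integ_cst0 a b); apply: eq_integ => x _.
  by rewrite big_geq.
have [mn|nm] := leqP m n; last first.
  rewrite big_geq// -[RHS](integ_cst0 a b); apply: eq_integ => x _.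
  by rewrite big_geq.
have fi' k : (m <= k < n)%N -> L1on a b (f k).
  by move=> /andP[mk kn]; apply: fi; rewrite mk ltnS ltnW.
rewrite big_nat_recr//= -IH// -integD; last 2 first.
- exact: L1on_sum.
- by apply: fi; rewrite mn ltnSn.
by apply: eq_integ => x _; rewrite big_nat_recr.
Qed.

(** * Translation of the variable *)

Lemma pushforward_shift c (A : set R) : measurable A ->
  pushforward mu (fun x : measurableTypeR R => x + c : measurableTypeR R) A = mu A.
Proof.
(* By uniqueness of Lebesgue measure, only half-open intervals have to be checked. *)
move=> mA; apply/esym/lebesgue_measure_unique => //=; first exact: measurable_funD.
move=> _ _ [[a b] _ <-].
rewrite /pushforward (_ : _ @^-1` _ = `]a - c, b - c]%classic); last first.
  by apply/seteqP; split=> x /=; rewrite !in_itv/= ltrBlDr lerBrDr.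
rewrite !lebesgue_measure_itv/= !lte_fin ltrD2r.
by case: ifP => // _; congr (_%:E); rewrite opprB addrA subrK.
Qed.

Lemma preimage_shift a b c : (fun x : R => x + c) @^-1` `[a, b] = `[a - c, b - c]%classic.
Proof. by apply/seteqP; split=> x /=; rewrite !in_itv/= lerBlDr lerBrDr. Qed.

Lemma measurable_shift a b c f : measurable_fun `[a, b] f ->
  measurable_fun `[a - c, b - c] (fun x => f (x + c)).
Proof.
move=> mf; apply: (@measurable_comp _ _ _ _ _ _ `[a, b] f) => //.
- by move=> _ [x /= + <-]; rewrite !in_itv/= lerBlDr lerBrDr.
- by apply: measurable_funD.
Qed.

Lemma ge0_integral_shift a b c (f : R -> \bar R) : measurable_fun `[a, b] f ->
  (forall x, (0 <= f x)%E) ->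
  (\int[mu]_(x in `[(a - c)%R, (b - c)%R]) f (x + c)%R = \int[mu]_(x in `[a, b]) f x)%E.
Proof.
move=> mf f0; rewrite -preimage_shift.
have ms : measurable_fun setT (fun x : measurableTypeR R => x + c : measurableTypeR R).
  by apply: measurable_funD.
rewrite -(@ge0_integral_pushforward _ _ _ _ _ _ ms mu `[a, b] f)//.
by apply: eq_measure_integral => A mA _; exact: pushforward_shift.
Qed.

Lemma L2on_shift a b c f : L2on a b f -> L2on (a - c) (b - c) (fun x => f (x + c)).
Proof.
move=> [mf If]; split; first exact: measurable_shift.
rewrite (@ge0_integral_shift a b c (fun x => (f x ^+ 2)%:E))//.
- by apply/measurable_EFinP; exact: measurable_funX.
- by move=> x; rewrite lee_fin sqr_ge0.
Qed.

Lemma integ_shift {a b} c f : L1on a b f ->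
  integ (a - c) (b - c) (fun x => f (x + c)) = integ a b f.
Proof.
move=> If; rewrite /integ /Rintegral [in RHS]integralE [in LHS]integralE.
have mf := measurable_int mu If.
rewrite -(@ge0_integral_shift a b c ((EFin \o f)^\+)%E)//; last exact: measurable_funepos.
rewrite -(@ge0_integral_shift a b c ((EFin \o f)^\-)%E)//; last exact: measurable_funeneg.
congr fine; congr (_ + _)%E; last congr (- _)%E;
  by apply: eq_integral => x _; rewrite ?funeposE ?funenegE.
Qed.

(* [ac2 a b F f]: on [a, b], [F] is absolutely continuous with derivative [f] in L^2. *)
Definition ac2 a b F f :=
  L2on a b f /\ forall t, a <= t <= b -> F t = F a + integ a t f.

Lemma ac2_L1on a b F f t : a <= t <= b -> ac2 a b F f -> L1on a t f.
Proof. by move=> /andP[_ tb] [/L2on_L1on Lf _]; apply: L1onS Lf. Qed.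

Lemma ac2_continuous a b F f : a <= b -> ac2 a b F f -> {within `[a, b], continuous F}.
Proof.
move=> ab [Lf Ff].
have cF := parameterized_integral_continuous ab (L2on_L1on Lf).
apply: (@subspace_eq_continuous _ _ _ (fun t => F a + integ a t f)).
  by move=> t /set_mem/=; rewrite in_itv/= => /Ff/esym.
move=> x; apply: cvgD; first exact: cvg_cst.
exact: cF.
Qed.

Lemma ac2_L2 a b F f : a <= b -> ac2 a b F f -> L2on a b F.
Proof. by move=> ab /(ac2_continuous ab); exact: L2on_continuous. Qed.

Lemma ac2_ext a b F f G g : a <= b -> (forall t, a <= t <= b -> F t = G t) ->
  (forall t, a < t < b -> f t = g t) -> ac2 a b F f -> ac2 a b G g.
Proof.
move=> ab FG fg acF; have [Lf Ff] := acF; split; first exact: L2on_ext Lf.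
move=> t tab; rewrite -!FG ?lexx ?ab// Ff//; congr (_ + _).
apply: integ_ext; last exact: (ac2_L1on tab acF).
move=> x /andP[ax xt]; apply: fg; rewrite ax (lt_le_trans xt)//.
by case/andP: tab.
Qed.

Lemma ac2D a b F f G g : ac2 a b F f -> ac2 a b G g ->
  ac2 a b (fun t => F t + G t) (fun t => f t + g t).
Proof.
move=> acF acG; have [Lf Ff] := acF; have [Lg Gg] := acG.
split; first exact: L2onD.
move=> t tab; rewrite Ff// Gg// integD; [ring|exact: (ac2_L1on tab acF)|exact: (ac2_L1on tab acG)].
Qed.

Lemma ac2Z a b k F f : ac2 a b F f -> ac2 a b (fun t => k * F t) (fun t => k * f t).
Proof.
move=> acF; have [Lf Ff] := acF.
split; first exact: L2onZ.
by move=> t tab; rewrite Ff// integZ; [ring|exact: (ac2_L1on tab acF)].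
Qed.

Lemma ac2_cst a b k : ac2 a b (fun=> k) (fun=> 0).
Proof.
split; first exact: L2on_cst.
by move=> t _; rewrite integ_cst0 addr0.
Qed.

Lemma ac2N a b F f : ac2 a b F f -> ac2 a b (fun t => - F t) (fun t => - f t).
Proof.
move=> /(ac2Z (-1)).
by under eq_fun do rewrite mulN1r; under [X in ac2 _ _ _ X]eq_fun do rewrite mulN1r.
Qed.

Lemma ac2B a b F f G g : ac2 a b F f -> ac2 a b G g ->
  ac2 a b (fun t => F t - G t) (fun t => f t - g t).
Proof. by move=> acF /ac2N; exact: ac2D. Qed.

Lemma ac2_sum a b m n (F f : nat -> R -> R) :
  (forall k, (m <= k < n)%N -> ac2 a b (F k) (f k)) ->
  ac2 a b (fun x => \sum_(m <= k < n) F k x) (fun x => \sum_(m <= k < n) f k x).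
Proof.
move=> Ff; split.
  by apply: L2on_sum => k /Ff[].
move=> t tab; rewrite integ_sum; last by move=> k /Ff Fk; exact: (ac2_L1on tab Fk).
rewrite -big_split/=; apply: eq_big_nat => k /Ff[_]; exact.
Qed.

Lemma ac2_integ a b f : L2on a b f -> ac2 a b (fun t => integ a t f) f.
Proof. by move=> Lf; split=> // t _; rewrite integ1 add0r. Qed.

Lemma ac2_S a b a' b' F f : a <= a' -> a' <= b' -> b' <= b -> ac2 a b F f -> ac2 a' b' F f.
Proof.
move=> aa ab bb acF; have [Lf Ff] := acF; split; first exact: L2onS Lf.
move=> t /andP[at_ tb]; rewrite Ff ?(le_trans aa) ?(le_trans tb)//.
have tab : a <= t <= b by rewrite (le_trans aa) ?(le_trans tb).
rewrite (@integ_cat a a' t)//; last exact: (ac2_L1on tab acF).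
by rewrite (Ff a') ?aa ?(le_trans ab)// addrA.
Qed.

Lemma ac2_cat a b c F f : a <= b -> b <= c -> ac2 a b F f -> ac2 b c F f -> ac2 a c F f.
Proof.
move=> ab bc [Lf Ff] [Lg Gg].
have Lc : L2on a c f by exact: L2on_cat Lf Lg.
split=> // t /andP[at_ tc].
have [tb|/ltW bt] := leP t b; first by rewrite Ff ?at_.
rewrite Gg ?bt// Ff ?ab ?lexx// (@integ_cat a b t)// ?addrA//.
by apply: L1onS (L2on_L1on Lc).
Qed.

Lemma ac2_shift a b c F f : ac2 a b F f ->
  ac2 (a - c) (b - c) (fun t => F (t + c)) (fun t => f (t + c)).
Proof.
move=> acF; have [Lf Ff] := acF; split; first exact: L2on_shift.
move=> t; rewrite lerBlDr lerBrDr => tab; rewrite Ff// subrK; congr (_ + _).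
by rewrite -(integ_shift c (ac2_L1on tab acF)) addrK.
Qed.

(* Fubini on the triangle y <= x of the square [a, b]^2. *)
Lemma integ_triangle a b f g : L1on a b f -> L1on a b g ->
  integ a b (fun x => f x * integ a x g) = integ a b (fun y => g y * integ y b f).
Proof.
move=> If Ig.
pose D := `[a, b]%classic.
pose p : measurableTypeR R -> R := f \_ D; pose q : measurableTypeR R -> R := g \_ D.
have patch0 (u : R -> R) x : ~~ (a <= x <= b) -> (u \_ D) x = 0.
  by move=> /negbTE xab; rewrite patchE mem_itvcc xab.
have patch1 (u : R -> R) x : a <= x <= b -> (u \_ D) x = u x.
  by move=> xab; rewrite patchE mem_itvcc xab.
have IT (u : R -> R) : L1on a b u -> mu.-integrable setT (EFin \o (u \_ D)).
  move=> Iu; rewrite -restrict_EFin.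
  by have /= -> // := (@integrable_mkcond _ _ _ mu D (EFin \o u) (measurable_itv _)).1 Iu.
have Ip : mu.-integrable setT (EFin \o p).
  exact: IT If.
have Iq : mu.-integrable setT (EFin \o q).
  exact: IT Ig.
have mp : measurable_fun setT p by apply/measurable_EFinP; exact: measurable_int Ip.
have mq : measurable_fun setT q by apply/measurable_EFinP; exact: measurable_int Iq.
have mpq : measurable_fun setT (fun z : measurableTypeR R * measurableTypeR R => p z.1 * q z.2).
  apply: measurable_funM.
    exact: (measurableT_comp mp measurable_fst).
  exact: (measurableT_comp mq measurable_snd).
pose h := fun z : measurableTypeR R * measurableTypeR R =>
  if (z.2 : R) <= z.1 then p z.1 * q z.2 else 0.
have mh : measurable_fun setT h.
  apply: measurable_fun_ifT => //.
  apply: measurable_fun_ler; [exact: measurable_snd|exact: measurable_fst].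
(* The absolute value of the tensor product factors, so Tonelli gives its integrability; cutting it
   down to the triangle then only decreases it. *)
have Ipq : (mu \x mu)%E.-integrable setT (EFin \o (fun z => p z.1 * q z.2)).
  apply/integrable12ltyP; first exact/measurable_EFinP.
  rewrite (_ : (fun x => _) = (fun x => `|(p x)%:E| * \int[mu]_y `|(q y)%:E|)%E); last first.
    apply/funext => x; rewrite -ge0_integralZl//; last first.
      by apply: measurableT_comp => //; exact/measurable_EFinP.
    by apply: eq_integral => y _ /=; rewrite normrM.
  have /integrableP[_ lq] := Iq.
  have /integrableP[_ lp] := Ip.
  rewrite ge0_integralZr//; last 2 first.
  - by apply: measurableT_comp => //; exact/measurable_EFinP.
  - exact: integral_ge0.
  by apply: lte_mul_pinfty => //; [exact: integral_ge0|rewrite ge0_fin_numE//; exact: integral_ge0].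
have Ih : (mu \x mu)%E.-integrable setT (EFin \o h).
  apply: le_integrable Ipq => //; first exact/measurable_EFinP.
  by move=> z _; rewrite /h /= lee_fin; case: ifP => // _; rewrite normr0.
have := Fubini Ih.
have intE u c d : L1on c d u -> (\int[mu]_(x in `[c, d]) (u x)%:E)%E = (integ c d u)%:E.
  by move=> Iu; rewrite /integ /Rintegral fineK//; exact: integrable_fin_num.
have inE1 x : (\int[mu]_y (EFin \o h) (x, y))%E = (((fun x => f x * integ a x g) \_ D) x)%:E.
  have [xab|xab] := boolP (a <= x <= b); last first.
    rewrite patch0// integral0_eq// => y _; rewrite /h /= /p patch0//.
    by rewrite mul0r; case: ifP.
  have [ax xb] := andP xab.
  have Igx : L1on a x g by apply: L1onS Ig.
  rewrite patch1// EFinM -intE// -integralZl// [RHS]integral_mkcond.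
  apply: eq_integral => y _; rewrite /h /= /p /q patch1// [RHS]patchE mem_itvcc.
  have [yx|xy] := leP y x; last by rewrite andbF.
  have [ay|ya] := leP a y; last by rewrite patch0 ?[a <= y]leNgt ?ya ?mulr0.
  by rewrite patch1 ?ay ?(le_trans yx).
have inE2 y : (\int[mu]_x (EFin \o h) (x, y))%E = (((fun y => g y * integ y b f) \_ D) y)%:E.
  have [yab|yab] := boolP (a <= y <= b); last first.
    rewrite patch0// integral0_eq// => x _; rewrite /h /= /q patch0//.
    by rewrite mulr0; case: ifP.
  have [ay yb] := andP yab.
  have Ify : L1on y b f by apply: L1onS If.
  rewrite patch1// EFinM -intE// -integralZl// [RHS]integral_mkcond.
  apply: eq_integral => x _; rewrite /h /= /p /q [(g \_ D) y]patch1// [RHS]patchE mem_itvcc.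
  have [yx|xy] := leP y x => //=.
  have [xb|bx] := leP x b; last by rewrite patch0 ?[x <= b]leNgt ?bx ?andbF ?mul0r.
  by rewrite patch1 ?xb ?(le_trans ay)// mulrC.
under eq_integral do rewrite inE1.
under [X in _ = X -> _]eq_integral do rewrite inE2.
by move=> /(congr1 fine); rewrite /integ [X in _ -> X = _]Rintegral_mkcond [X in _ -> _ = X]Rintegral_mkcond.
Qed.

(** Integration by parts without pointwise derivatives. After writing F and G as primitives, the
    only nontrivial term is the double integral of f(x) g(y) over y <= x; Fubini exchanges it for
    the full product of the two integrals minus the integral over the other triangle. *)
Lemma ac2M a b F f G g : a <= b -> ac2 a b F f -> ac2 a b G g ->
  ac2 a b (fun t => F t * G t) (fun t => f t * G t + F t * g t).
Proof.
move=> ab acF acG; have [Lf Ff] := acF; have [Lg Gg] := acG.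
have L1 : L2on a b (fun t => G t * f t).
  by apply: L2on_continuousM => //; exact: ac2_continuous acG.
have L2 : L2on a b (fun t => F t * g t).
  by apply: L2on_continuousM => //; exact: ac2_continuous acF.
have L3 : L2on a b (fun t => f t * G t).
  by under eq_fun do rewrite mulrC.
split; first exact: L2onD.
move=> t tab; have [at_ tb] := andP tab.
have If : L1on a t f := ac2_L1on tab acF.
have Ig : L1on a t g := ac2_L1on tab acG.
have LF : L2on a t (fun x => integ a x f).
  by apply: ac2_L2 => //; apply: ac2_integ; exact: L2onS Lf.
have LG : L2on a t (fun x => integ a x g).
  by apply: ac2_L2 => //; apply: ac2_integ; exact: L2onS Lg.
have Lft : L2on a t f by exact: L2onS Lf.
have Lgt : L2on a t g by exact: L2onS Lg.
have I1 : L1on a t (fun x => f x * integ a x g) by exact: L2on_L1onM.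
have I2 : L1on a t (fun x => g x * integ a x f) by exact: L2on_L1onM.
have sub x : a <= x <= t -> a <= x <= b.
  by move=> /andP[-> xt] /=; exact: le_trans tb.
rewrite integD; last 2 first.
- by apply: L1onS (L2on_L1on L3).
- by apply: L1onS (L2on_L1on L2).
rewrite (eq_integ (g := fun x => G a * f x + f x * integ a x g)); last first.
  by move=> x xat; rewrite Gg ?sub//; ring.
rewrite (eq_integ (f := fun x => F x * g x) (g := fun x => F a * g x + g x * integ a x f)); last first.
  by move=> x xat; rewrite Ff ?sub//; ring.
rewrite !integD ?integZ//; [|exact: L1onZ..].
rewrite integ_triangle//.
rewrite (eq_integ (f := fun y => g y * integ y t f)
  (g := fun x => integ a t f * g x - g x * integ a x f)); last first.
  move=> x /andP[ax xt]; rewrite (integ_cat ax xt If); ring.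
rewrite integB ?integZ//; last exact: L1onZ.
by rewrite Ff// Gg//; ring.
Qed.

End L2.

(** * Null functions, exponentials and hyperbolic convolutions *)

Section Convolution.
Context {R : realType}.
Set Implicit Arguments.
Unset Strict Implicit.
Implicit Types (a b c t : R) (f g h F G : R -> R).
Local Notation mu := (@lebesgue_measure R).
Local Notation L1on a b f := (mu.-integrable `[a, b] (EFin \o f)).

(** Extended by zero, f has an identically zero primitive on the whole line, and by Lebesgue
    differentiation f is almost everywhere the derivative of that primitive. *)
Lemma ae_eq0_of_integ0 a b f : L1on a b f ->
  (forall t, a <= t <= b -> integ a t f = 0) ->
  {ae mu, forall x, a <= x <= b -> f x = 0}.
Proof.
move=> If f0.
have [ab|ba] := leP a b; last first.
  apply: aeW => x /andP[ax xb]; by have := lt_le_trans ba (le_trans ax xb); rewrite ltxx.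
pose g : R -> R := f \_ `[a, b].
have IT : mu.-integrable setT (EFin \o g).
  by rewrite -restrict_EFin;
  have /= -> // := (@integrable_mkcond _ _ _ mu _ (EFin \o f) (measurable_itv `[a, b])).1 If.
have := FTC1Ny (f := g).
have Iy y : mu.-integrable `]-oo, y] (EFin \o g) by exact: integrableS IT.
move=> /(_ Iy (integrable_locally (measurable_itv _) If)) /=.
have F0 : (fun x => \int[mu]_(t in `]-oo, x]) g t)%R = cst 0.
  apply/funext => x; rewrite /g -Rintegral_mkcondr.
  (* The extension only sees [a, min(x, b)], which is empty for x < a and otherwise an interval
     covered by the hypothesis. *)
  have -> : `]-oo, x] `&` `[a, b] = `[a, Num.min x b]%classic.
    apply/seteqP; split=> t /=; rewrite !in_itv/= le_min.
      by move=> [-> /andP[-> ->]].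
    by move=> /and3P[-> -> ->].
  have [ax|xa] := leP a x.
    by apply: f0; rewrite le_min ax ab ge_min lexx orbT.
  rewrite set_itv_ge ?Rintegral_set0// bnd_simp -ltNge.
  by rewrite gt_min xa.
apply: filterS; first exact: (ae_filter_ringOfSetsType mu).
move=> x [_]; rewrite F0 derive1_cst => + xab.
by rewrite /g patchE mem_itvcc xab => <-.
Qed.

Lemma integ_ae_eq a b f g : L1on a b f -> L1on a b g ->
  {ae mu, forall x, a <= x <= b -> f x = g x} -> integ a b f = integ a b g.
Proof.
move=> If Ig fg; rewrite /integ /Rintegral; congr fine.
apply: ae_eq_integral => //; [exact: measurable_int If|exact: measurable_int Ig|].
move: fg; apply: filterS; first exact: (ae_filter_ringOfSetsType mu).
by move=> x fg /=; rewrite in_itv/= => /fg ->.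
Qed.

Lemma integ_sqr_eq0 a b f : L2on a b f -> integ a b (fun x => f x ^+ 2) <= 0 ->
  {ae mu, forall x, a <= x <= b -> f x = 0}.
Proof.
move=> Lf f0; have [mf I2] := (L2onP a b f).1 Lf.
have F0 : (\int[mu]_(x in `[a, b]) `|(f x ^+ 2)%:E| = 0)%E.
  under eq_integral do rewrite /= ger0_norm ?sqr_ge0//.
  rewrite -[LHS]fineK; last exact: integrable_fin_num.
  congr (_%:E); apply: le_anti; rewrite f0/=; apply: Rintegral_ge0 => x _; exact: sqr_ge0.
have mf2 : measurable_fun `[a, b] (fun x => (f x ^+ 2)%:E).
  by apply/measurable_EFinP; exact: measurable_funX.
have := (ae_eq_integral_abs mu (measurable_itv _) mf2).1 F0.
apply: filterS => x /= h xab; have := h; rewrite in_itv/= => /(_ xab) [/eqP].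
by rewrite sqrf_eq0 => /eqP.
Qed.

(** The one function differentiated classically; the hyperbolic functions and all convolutions below
    inherit their derivatives from it by algebra. *)
Lemma ac2_expR a b k : ac2 a b (fun t => expR (k * t)) (fun t => k * expR (k * t)).
Proof.
have dE t : is_derive t 1 (fun t => expR (k * t)) (k * expR (k * t)).
  have dk : is_derive t 1 (fun t : R => k * t) k.
    rewrite -[X in is_derive _ _ _ X]mulr1; exact: (is_deriveZ k).
  have := is_derive1_comp (is_derive_expR (k * t)) dk.
  by rewrite mulrC.
have cE : continuous (fun t => expR (k * t)).
  move=> t; apply: differentiable_continuous.
  by apply/derivable1_diffP; exact: ex_derive.
have ckE : continuous (fun t => k * expR (k * t)).
  move=> t; apply: cvgM; [exact: cvg_cst|exact: cE].
split.
  apply: L2on_continuous; exact: continuous_subspaceT.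
move=> t /andP[at_ _]; move: at_; rewrite le_eqVlt => /predU1P[<-|at_].
  by rewrite integ1 addr0.
rewrite /integ /Rintegral (continuous_FTC2 (F := fun t => expR (k * t)) at_)//=.
- by rewrite [RHS]addrC subrK.
- exact: continuous_subspaceT.
- split=> [x _|/=|/=]; first exact: ex_derive.
    apply: cvg_at_right_filter; exact: cE.
  apply: cvg_at_left_filter; exact: cE.
- by move=> x _; rewrite derive1E; exact: derive_val.
Qed.

Definition convol (K f : R -> R) t := integ 0 t (fun s => K (t - s) * f s).

(** The exponential law separates t from the integration variable, so the convolution becomes a
    product to which [ac2M] applies, and no differentiation under the integral sign is needed. *)
Lemma convol_expE b k f t : L2on 0 b f -> 0 <= t <= b ->
  convol (fun s => expR (k * s)) f t =
  expR (k * t) * integ 0 t (fun s => expR (- k * s) * f s).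
Proof.
move=> Lf /andP[t0 tb]; rewrite /convol -integZ; last first.
  apply: L2on_L1on; apply: L2on_continuousM; last exact: L2onS Lf.
  exact: ac2_continuous t0 (ac2_expR _ _ _).
apply: eq_integ => s _; rewrite mulrA -expRD; congr (expR _ * _); ring.
Qed.

Lemma L2on_expM b k f : 0 <= b -> L2on 0 b f -> L2on 0 b (fun s => expR (k * s) * f s).
Proof.
move=> b0; apply: L2on_continuousM; exact: ac2_continuous b0 (ac2_expR _ _ _).
Qed.

Lemma ac2_convol_exp b k f : 0 <= b -> L2on 0 b f ->
  ac2 0 b (convol (fun s => expR (k * s)) f)
    (fun t => k * convol (fun s => expR (k * s)) f t + f t).
Proof.
move=> b0 Lf.
have := ac2M b0 (ac2_expR 0 b k) (ac2_integ (L2on_expM (- k) b0 Lf)).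
apply: ac2_ext => // t tb; first by rewrite (convol_expE _ Lf).
rewrite (convol_expE _ Lf); last by case/andP: tb => /ltW -> /ltW ->.
rewrite -mulrA; congr (_ + _).
by rewrite mulrA -expRD mulNr subrr expR0 mul1r.
Qed.

Lemma convol0 K f : convol K f 0 = 0.
Proof. by rewrite /convol integ1. Qed.

Lemma L2on_convol_exp b k f t : L2on 0 b f -> 0 <= t <= b ->
  L2on 0 t (fun s => expR (k * (t - s)) * f s).
Proof.
move=> Lf /andP[t0 tb].
apply: (@L2on_ext _ _ _ (fun s => expR (k * t) * (expR (- k * s) * f s))).
  by move=> s _; rewrite mulrA -expRD; congr (expR _ * _); ring.
by apply/L2onZ/L2on_expM => //; exact: L2onS Lf.
Qed.

Lemma L2on_convol_cosh b k f t : L2on 0 b f -> 0 <= t <= b ->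
  L2on 0 t (fun s => coshR (k * (t - s)) * f s).
Proof.
move=> Lf tb.
apply: L2on_ext (L2onZ 2^-1 (L2onD (L2on_convol_exp k Lf tb) (L2on_convol_exp (- k) Lf tb))).
by move=> s _; rewrite /coshR mulNr; field.
Qed.

Lemma L2on_convol_sinh b k f t : L2on 0 b f -> 0 <= t <= b ->
  L2on 0 t (fun s => sinhR (k * (t - s)) * f s).
Proof.
move=> Lf tb.
apply: L2on_ext (L2onZ 2^-1 (L2onB (L2on_convol_exp k Lf tb) (L2on_convol_exp (- k) Lf tb))).
by move=> s _; rewrite /sinhR mulNr; field.
Qed.

Lemma convol_coshE b k f t : L2on 0 b f -> 0 <= t <= b ->
  convol (fun s => coshR (k * s)) f t =
  2^-1 * (convol (fun s => expR (k * s)) f t + convol (fun s => expR (- k * s)) f t).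
Proof.
move=> Lf tb.
have Le l := L2on_L1on (L2on_convol_exp l Lf tb).
rewrite /convol -integD// -integZ; last exact: L1onD.
by apply: eq_integ => s _; rewrite /coshR mulNr; field.
Qed.

Lemma convol_sinhE b k f t : L2on 0 b f -> 0 <= t <= b ->
  convol (fun s => sinhR (k * s)) f t =
  2^-1 * (convol (fun s => expR (k * s)) f t - convol (fun s => expR (- k * s)) f t).
Proof.
move=> Lf tb.
have Le l := L2on_convol_exp l Lf tb.
rewrite /convol -integB ?(L2on_L1on (Le _))// -integZ; last exact: L2on_L1on (L2onB (Le _) (Le _)).
by apply: eq_integ => s _; rewrite /sinhR mulNr; field.
Qed.

Lemma ac2_convol_cosh b k f : 0 <= b -> L2on 0 b f ->
  ac2 0 b (convol (fun s => coshR (k * s)) f)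
    (fun t => f t + k * convol (fun s => sinhR (k * s)) f t).
Proof.
move=> b0 Lf.
have := ac2Z 2^-1 (ac2D (ac2_convol_exp k b0 Lf) (ac2_convol_exp (- k) b0 Lf)).
apply: ac2_ext => // t tb; first by rewrite (convol_coshE _ Lf).
rewrite (convol_sinhE _ Lf); last by case/andP: tb => /ltW -> /ltW ->.
by field.
Qed.

Lemma ac2_convol_sinh b k f : 0 <= b -> L2on 0 b f ->
  ac2 0 b (convol (fun s => sinhR (k * s)) f)
    (fun t => k * convol (fun s => coshR (k * s)) f t).
Proof.
move=> b0 Lf.
have := ac2Z 2^-1 (ac2B (ac2_convol_exp k b0 Lf) (ac2_convol_exp (- k) b0 Lf)).
apply: ac2_ext => // t tb; first by rewrite (convol_sinhE _ Lf).
rewrite (convol_coshE _ Lf); last by case/andP: tb => /ltW -> /ltW ->.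
by field.
Qed.

Lemma ac2_coshR a b k : a <= b ->
  ac2 a b (fun t => coshR (k * t)) (fun t => k * sinhR (k * t)).
Proof.
move=> ab; have := ac2Z 2^-1 (ac2D (ac2_expR a b k) (ac2_expR a b (- k))).
by apply: ac2_ext => // t _; rewrite /coshR /sinhR ?(mulNr k t); field.
Qed.

Lemma ac2_sinhR a b k : a <= b ->
  ac2 a b (fun t => sinhR (k * t)) (fun t => k * coshR (k * t)).
Proof.
move=> ab; have := ac2Z 2^-1 (ac2B (ac2_expR a b k) (ac2_expR a b (- k))).
by apply: ac2_ext => // t _; rewrite /coshR /sinhR ?(mulNr k t); field.
Qed.

(** Uniqueness for W' = k W + f: the difference from the convolution, multiplied by exp(-k t), has
    derivative zero and starts at zero. *)
Lemma ac2_linear_convol b k f W : L2on 0 b f -> W 0 = 0 ->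
  ac2 0 b W (fun t => k * W t + f t) ->
  forall t, 0 <= t <= b -> W t = convol (fun s => expR (k * s)) f t.
Proof.
move=> Lf W0 acW t tb; have [t0 tb'] := andP tb.
have b0 := le_trans t0 tb'.
have acD := ac2B acW (ac2_convol_exp k b0 Lf).
have [_ /(_ t tb)] := ac2M b0 (ac2_expR 0 b (- k)) acD.
rewrite W0 convol0 subrr mulr0 add0r (eq_integ (g := fun=> 0)); last by move=> s _; ring.
rewrite integ_cst0 => /eqP; rewrite mulf_eq0 gt_eqF ?expR_gt0//= subr_eq0.
by move/eqP.
Qed.

Lemma sinhR_gt0 (x : R) : 0 < x -> 0 < sinhR x.
Proof.
by move=> x0; rewrite divr_gt0// subr_gt0 ltr_expR; lra.
Qed.

Lemma sinhR0 : sinhR (0 : R) = 0.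
Proof. by rewrite /sinhR oppr0 subrr mul0r. Qed.

End Convolution.

(** * The reduced linear-quadratic problem *)

Section LinearQuadratic.
Context {R : realType}.
Set Implicit Arguments.
Unset Strict Implicit.
Implicit Types t : R.
Variables (N : nat) (d a : nat -> R) (f : nat -> R -> R) (b c : R).
Hypothesis b0 : 0 <= b.
Hypothesis a_gt0 : 0 < \sum_(0 <= k < N.+1) a k ^+ 2.
Hypothesis Lf : forall s, (1 <= s < N.+1)%N -> L2on 0 b (f s).

Local Notation w := (ahat N d a).
Local Notation d2 := (dsq N d).
Local Notation C s := (convol (fun t => coshR (w * t)) (f s)).
Local Notation S s := (convol (fun t => sinhR (w * t)) (f s)).

Lemma dsq_gt0 : 0 < d2.
Proof. by rewrite ltr_wpDr// sumr_ge0// => k _; exact: sqr_ge0. Qed.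

Lemma ahat_gt0 : 0 < w.
Proof. by rewrite sqrtr_gt0 mulr_gt0// invr_gt0 dsq_gt0. Qed.

Lemma dsq_ahat_sqr : d2 * w ^+ 2 = \sum_(0 <= k < N.+1) a k ^+ 2.
Proof.
rewrite sqr_sqrtr; last by rewrite mulr_ge0 ?invr_ge0 ?ltW// dsq_gt0.
by rewrite mulrA divff ?mul1r// gt_eqF// dsq_gt0.
Qed.

(** This is [uhat0] with arbitrary L^2 data in place of the [phi s] and a free constant in place of
    [cconst], so the two agree by computation once these are substituted. *)
Definition lq_control t :=
  d2^-1 *
  (\sum_(1 <= s < N.+1)
      integ 0 t (fun tau =>
        ((d s * a 0%N - a s) * coshR (w * (t - tau)) +
         (a s * a 0%N / w - d s * w) * sinhR (w * (t - tau))) * f s tau)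
   - \sum_(1 <= s < N.+1) d s * f s t
   + c * (coshR (w * t) - a 0%N / w * sinhR (w * t))).

(* The correction of xtilde: the solution of X' = a_0 X + lq_control, X(0) = 0. *)
Definition lq_state t :=
  d2^-1 * (c / w * sinhR (w * t) - \sum_(1 <= s < N.+1) (d s * C s t + a s / w * S s t)).

(* Up to a multiple of [lq_state], the momentum in the Euler-Lagrange equation. *)
Definition lq_costate t :=
  c * coshR (w * t) - \sum_(1 <= s < N.+1) (d s * w * S s t + a s * C s t).

(** The momentum relation costate = d^2 W' + sum d_s f_s solved for W'. It is only in L^2, since the
    f_s are. *)
Definition lq_dstate t := d2^-1 * (lq_costate t - \sum_(1 <= s < N.+1) d s * f s t).

Lemma lq_state0 : lq_state 0 = 0.
Proof.
rewrite /lq_state mulr0 sinhR0 mulr0 big1 ?subr0 ?mulr0// => s _.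
by rewrite !convol0 !mulr0 addr0.
Qed.

Lemma ac2_lq_state : ac2 0 b lq_state lq_dstate.
Proof.
have w0 : w != 0 by rewrite gt_eqF// ahat_gt0.
have := ac2Z d2^-1 (ac2B (ac2Z (c / w) (ac2_sinhR w b0))
  (ac2_sum (m := 1) (n := N.+1) (F := fun s t => d s * C s t + a s / w * S s t)
    (fun s hs => ac2D (ac2Z (d s) (ac2_convol_cosh w b0 (Lf hs)))
                      (ac2Z (a s / w) (ac2_convol_sinh w b0 (Lf hs)))))).
apply: ac2_ext => // t _; rewrite /lq_dstate /lq_costate -addrA -opprD -big_split/=.
congr (_ * (_ - _)); first by field.
by apply: eq_bigr => s _; field.
Qed.

(** Differentiating the hyperbolic terms produces w^2 d^2 times the state; the choice of w turns
    this factor into the sum of the a_k^2, as the Euler-Lagrange equation requires. *)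
Lemma ac2_lq_costate : ac2 0 b lq_costate
  (fun t => (\sum_(0 <= k < N.+1) a k ^+ 2) * lq_state t - \sum_(1 <= s < N.+1) a s * f s t).
Proof.
have w0 : w != 0 by rewrite gt_eqF// ahat_gt0.
have d20 : d2 != 0 by rewrite gt_eqF// dsq_gt0.
have := ac2B (ac2Z c (ac2_coshR w b0))
  (ac2_sum (m := 1) (n := N.+1) (F := fun s t => d s * w * S s t + a s * C s t)
    (fun s hs => ac2D (ac2Z (d s * w) (ac2_convol_sinh w b0 (Lf hs)))
                      (ac2Z (a s) (ac2_convol_cosh w b0 (Lf hs))))).
apply: ac2_ext => // t _; rewrite -dsq_ahat_sqr /lq_state.
rewrite [in RHS]mulrA (_ : d2 * w ^+ 2 * d2^-1 = w ^+ 2); last by field.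
rewrite mulrBr -addrA -opprD mulr_sumr -big_split/=.
congr (_ - _); first by field.
by apply: eq_bigr => s _; field.
Qed.

(** Splitting the two kernels expresses the integrals through C and S, which regroup into a_0 times
    the sum in the state and minus the sum in the costate. *)
Lemma lq_controlE t : 0 <= t <= b -> lq_control t = lq_dstate t - a 0%N * lq_state t.
Proof.
move=> tb; have [t0 tb'] := andP tb.
have w0 : w != 0 by rewrite gt_eqF// ahat_gt0.
have intE s : (1 <= s < N.+1)%N ->
  integ 0 t (fun tau =>
        ((d s * a 0%N - a s) * coshR (w * (t - tau)) +
         (a s * a 0%N / w - d s * w) * sinhR (w * (t - tau))) * f s tau) =
  (d s * a 0%N - a s) * C s t + (a s * a 0%N / w - d s * w) * S s t.
  move=> /Lf Lfs.
  have L1 := L2on_L1on (L2on_convol_cosh w Lfs tb).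
  have L2 := L2on_L1on (L2on_convol_sinh w Lfs tb).
  rewrite /convol -!integZ// -?integD; [|exact: L1onZ..].
  by apply: eq_integ => x _; ring.
rewrite /lq_control /lq_dstate /lq_state /lq_costate (eq_big_nat _ _ intE).
have -> : \sum_(1 <= s < N.+1) ((d s * a 0%N - a s) * C s t +
    (a s * a 0%N / w - d s * w) * S s t) =
  a 0%N * \sum_(1 <= s < N.+1) (d s * C s t + a s / w * S s t) -
  \sum_(1 <= s < N.+1) (d s * w * S s t + a s * C s t).
  rewrite mulr_sumr -sumrB; apply: eq_bigr => s _; field.
  exact: w0.
move: (\sum_(1 <= s < N.+1) _) (\sum_(1 <= s < N.+1) _) (\sum_(1 <= s < N.+1) _) => x1 x2 x3.
by field; rewrite w0 gt_eqF// dsq_gt0.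
Qed.

Lemma L2on_lq_control : L2on 0 b lq_control.
Proof.
have [Ld _] := ac2_lq_state.
have LW := ac2_L2 b0 ac2_lq_state.
apply: (L2on_ext _ (L2onB Ld (L2onZ (a 0%N) LW))) => t /andP[t0 tb].
by rewrite lq_controlE// !ltW.
Qed.

(** Both sides solve X' = a_0 X + [lq_control] with X(0) = 0. This identifies the exponential
    integral in the formula for the control on [r_s, r_s + eps). *)
Lemma lq_stateE t : 0 <= t <= b ->
  lq_state t = convol (fun s => expR (a 0%N * s)) lq_control t.
Proof.
apply: ac2_linear_convol => //; first exact: L2on_lq_control.
- exact: lq_state0.
- apply: ac2_ext ac2_lq_state => // s /andP[s0 sb].
  by rewrite lq_controlE ?ltW//; ring.
Qed.

(** The origin of [cconst]: the end value of the state is affine in c with slope proportional to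
    sinh(w b), which is positive because w and b are, so c can be solved for. *)
Lemma lq_state_end X : 0 < b ->
  c = (sinhR (w * b))^-1 * (- (d2 * w * X) +
    integ 0 b (fun tau => \sum_(1 <= s < N.+1)
      (w * d s * coshR (w * (b - tau)) + a s * sinhR (w * (b - tau))) * f s tau)) ->
  lq_state b = - X.
Proof.
move=> b_gt0 cE.
have w0 := ahat_gt0; have wn0 : w != 0 by rewrite gt_eqF.
have d20 : d2 != 0 by rewrite gt_eqF// dsq_gt0.
have bb : 0 <= b <= b by rewrite b0 lexx.
have sn0 : sinhR (w * b) != 0 by rewrite gt_eqF// sinhR_gt0// mulr_gt0.
have Lk s : (1 <= s < N.+1)%N -> L2on 0 b (fun tau =>
    (w * d s * coshR (w * (b - tau)) + a s * sinhR (w * (b - tau))) * f s tau).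
  move=> /Lf Lfs; apply: L2on_ext (L2onD (L2onZ (w * d s) (L2on_convol_cosh w Lfs bb))
    (L2onZ (a s) (L2on_convol_sinh w Lfs bb))) => x _; ring.
have cS : c * sinhR (w * b) =
    - (d2 * w * X) + w * \sum_(1 <= s < N.+1) (d s * C s b + a s / w * S s b).
  rewrite cE mulrC mulrA divff// mul1r integ_sum; last by move=> s /Lk; exact: L2on_L1on.
  congr (_ + _); rewrite mulr_sumr; apply: eq_big_nat => s /Lf Lfs.
  have L1 := L2on_L1on (L2on_convol_cosh w Lfs bb).
  have L2 := L2on_L1on (L2on_convol_sinh w Lfs bb).
  rewrite mulrDr [X in _ = _ + X]mulrA [w * (a s / w)]mulrC divfK// mulrA /convol -!integZ// -?integD; [|exact: L1onZ..].
  by apply: eq_integ => x _; ring.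
rewrite /lq_state mulrAC cS; move: (\sum_(1 <= s < N.+1) _) => x.
by field; rewrite wn0.
Qed.

(* The coefficient of x'(t - r_k) in the equation, that of x'(t) being 1. *)
Definition lead (k : nat) : R := if k is 0%N then 1 else d k.

(* The value on [r_k, r_k + eps) of the control, shifted to [0, eps). *)
Definition lq_output k t := if k is 0%N then lq_control t else
  f k t + d k * lq_control t + (d k * a 0%N - a k) * lq_state t.

(** Each output is f_k + d_k W' - a_k W (without f_k and with leading coefficient 1 for k = 0). In
    the weighted sum the terms in W' and f_k combine into the costate, so the sum equals the costate
    minus a multiple of the state and can be differentiated. *)
Lemma lq_euler_lagrange : ac2 0 b (fun t => \sum_(0 <= k < N.+1) lead k * lq_output k t)
  (fun t => - \sum_(0 <= k < N.+1) a k * lq_output k t).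
Proof.
have d20 : d2 != 0 by rewrite gt_eqF// dsq_gt0.
(* A collects the cross terms between W' and W in the sum of squares of the outputs; it is the
   multiple of the state that separates momentum and costate. *)
pose A := a 0%N + \sum_(1 <= s < N.+1) d s * a s.
have := ac2B ac2_lq_costate (ac2Z A ac2_lq_state).
have E0 (g : nat -> R) : \sum_(0 <= k < N.+1) g k = g 0%N + \sum_(1 <= k < N.+1) g k.
  by rewrite big_nat_recl// [in RHS]big_add1.
apply: ac2_ext => // [t tb|t /andP[t0 tb]].
- rewrite E0 /= lq_controlE// (eq_big_nat _ _ (F1 := fun s => lead s * lq_output s t)
    (F2 := fun s => d s * (f s t + d s * lq_dstate t - a s * lq_state t))); last first.
    by case=> [|s]// _; rewrite /= lq_controlE//; ring.
  have -> : \sum_(1 <= s < N.+1) d s * (f s t + d s * lq_dstate t - a s * lq_state t) =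
    \sum_(1 <= s < N.+1) d s * f s t + (\sum_(1 <= s < N.+1) d s ^+ 2) * lq_dstate t
    - (\sum_(1 <= s < N.+1) d s * a s) * lq_state t.
    by rewrite !mulr_suml -big_split -sumrB/=; apply: eq_bigr => s _; ring.
  have -> : lq_costate t = d2 * lq_dstate t + \sum_(1 <= s < N.+1) d s * f s t.
    by rewrite /lq_dstate mulrA divff// mul1r subrK.
  by rewrite /A /dsq; ring.
- have tb' : 0 <= t <= b by rewrite !ltW.
  rewrite !E0 /= lq_controlE// (eq_big_nat _ _ (F1 := fun s => a s * lq_output s t)
    (F2 := fun s => a s * (f s t + d s * lq_dstate t - a s * lq_state t))); last first.
    by case=> [|s]// _; rewrite /= lq_controlE//; ring.
  have -> : \sum_(1 <= s < N.+1) a s * (f s t + d s * lq_dstate t - a s * lq_state t) =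
    \sum_(1 <= s < N.+1) a s * f s t + (\sum_(1 <= s < N.+1) d s * a s) * lq_dstate t
    - (\sum_(1 <= s < N.+1) a s ^+ 2) * lq_state t.
    by rewrite !mulr_suml -big_split -sumrB/=; apply: eq_bigr => s _; ring.
  by rewrite /A; ring.
Qed.

End LinearQuadratic.

(** * The delay system *)

Section DelaySystem.
Context {R : realType}.
Set Implicit Arguments.
Unset Strict Implicit.
Implicit Types t : R.
Local Notation mu := (@lebesgue_measure R).
Local Notation L1on a b f := (mu.-integrable `[a, b] (EFin \o f)).

Lemma big_nat_only m n s (F : nat -> R) : (m <= s < n)%N ->
  (forall k, (m <= k < n)%N -> k <> s -> F k = 0) -> \sum_(m <= k < n) F k = F s.
Proof.
move=> hs F0; rewrite (bigD1_seq s) ?mem_index_iota ?iota_uniq//=.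
rewrite big_seq_cond big1 ?addr0// => k; rewrite mem_index_iota => /andP[hk /eqP].
exact: F0.
Qed.

Variables (N : nat) (r d a : nat -> R) (y : R) (x0 dx0 : R -> R) (eps : R).
Hypothesis r0 : r 0%N = 0.
Hypothesis rN : r N = 1.
Hypothesis Wx0 : W12 x0 dx0.
Hypothesis yE : y = x0 0.
Hypothesis a_gt0 : 0 < \sum_(0 <= k < N.+1) a k ^+ 2.
Hypothesis e0 : 0 < eps.
Hypothesis gap : forall s, (1 <= s <= N)%N -> eps < r s - r s.-1.

Local Notation T := (1 + eps).
Local Notation ph := (phi N r d a y x0 dx0).
Local Notation xt := (xtilde N r d a y x0 dx0).
Local Notation cc := (cconst N r d a y x0 dx0 eps).
Local Notation u0 := (lq_control N d a ph cc).
Local Notation W := (lq_state N d a ph cc).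
Local Notation U := (lq_output N d a ph cc).
Local Notation uh := (uhat N r d a y x0 dx0 eps).

(** The windows [r_i, r_i + eps) are ordered and disjoint: while one delayed argument is in [0,
    eps), those of smaller delays are beyond eps and those of larger delays are negative. *)
Lemma delay_gap i j : (i < j)%N -> (j <= N)%N -> r i + eps < r j.
Proof.
elim: j => // j IH; rewrite ltnS leq_eqVlt => /predU1P[->|ij] jN.
  by have := gap (s := j.+1); rewrite jN /= => /(_ isT); lra.
have := IH ij (ltnW jN).
by have := gap (s := j.+1); rewrite jN /= => /(_ isT); have := e0; lra.
Qed.

Lemma delay_le i j : (i <= j)%N -> (j <= N)%N -> r i <= r j.
Proof.
rewrite leq_eqVlt => /predU1P[->//|ij jN]; have := delay_gap ij jN; have := e0; lra.
Qed.

Lemma delay_ge0 k : (k <= N)%N -> 0 <= r k.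
Proof. by move=> kN; rewrite -r0; exact: delay_le. Qed.

Lemma delay_le1 k : (k <= N)%N -> r k <= 1.
Proof. by move=> kN; rewrite -rN; exact: delay_le. Qed.

Lemma delay_gt_eps k : (1 <= k < N.+1)%N -> eps < r k.
Proof. by move=> /andP[k1 kN]; have := delay_gap k1 kN; rewrite r0 add0r. Qed.

Lemma initial_ac2 : ac2 (-1) 0 x0 dx0.
Proof. exact: Wx0. Qed.

Lemma initial_ac2_shift c p q : p <= q -> -1 <= p + c -> q + c <= 0 ->
  ac2 p q (fun t => x0 (t + c)) (fun t => dx0 (t + c)).
Proof.
move=> pq pc qc; have := ac2_shift c initial_ac2.
by apply: ac2_S => //; lra.
Qed.

Lemma initial_L2 c k p q : p <= q -> -1 <= p + c -> q + c <= 0 ->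
  L2on p q (fun t => d k * dx0 (t + c) - a k * x0 (t + c)).
Proof.
move=> pq pc qc; have H := initial_ac2_shift pq pc qc.
apply: L2onB; apply: L2onZ; first by case: H.
exact: ac2_L2 H.
Qed.

(** For t in [0, eps] all delayed arguments are negative, since eps < r_1. So the history enters
    only through this known function, and [xtilde] is the state under zero control by variation of
    constants. *)
Definition forcing t := \sum_(1 <= k < N.+1) (a k * x0 (t - r k) - d k * dx0 (t - r k)).

Lemma forcingE t :
  forcing t = - \sum_(1 <= k < N.+1) (d k * dx0 (t - r k) - a k * x0 (t - r k)).
Proof. by rewrite -sumrN; apply: eq_bigr => k _; rewrite opprB. Qed.

Lemma L2on_forcing : L2on 0 eps forcing.
Proof.
have : L2on 0 eps (fun t => - \sum_(1 <= k < N.+1) (d k * dx0 (t - r k) - a k * x0 (t - r k))).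
  apply/L2onN/L2on_sum => k hk; have := delay_gt_eps hk.
  case/andP: hk => _ /delay_le1 k1 ek.
  apply: initial_L2; [exact: ltW|lra|lra].
by apply: L2on_ext => t _; rewrite forcingE.
Qed.

Lemma xtilde0 : xt 0 = y.
Proof. by rewrite /xtilde mulr0 expR0 integ1 addr0 mul1r. Qed.

Lemma ac2_xtilde : ac2 0 eps xt (fun t => a 0%N * xt t + forcing t).
Proof.
have e0' := ltW e0.
have Lq := L2on_expM (- a 0%N) e0' L2on_forcing.
have := ac2M e0' (ac2_expR 0 eps (a 0%N)) (ac2D (ac2_cst 0 eps y) (ac2_integ Lq)).
apply: ac2_ext => // t _.
  rewrite /xtilde; congr (_ * (_ + _)); apply: eq_integ => s _.
  by rewrite mulNr.
rewrite add0r [X in _ + X = _]mulrA -expRD mulNr subrr expR0 mul1r; congr (_ + _).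
rewrite /xtilde mulrA; congr (_ * (_ + _)); apply: eq_integ => s _.
by rewrite mulNr.
Qed.

(** On [0, eps] the arguments t + r_s - r_k with k > s stay in [-1, 0] because r_s + eps < r_k, so
    only the given history is evaluated. *)
Lemma L2on_phi s : (1 <= s < N.+1)%N -> L2on 0 eps (ph s).
Proof.
move=> hs; have e0' := ltW e0; have es := delay_gt_eps hs; have [s1 sN] := andP hs.
have rs1 := delay_le1 sN.
apply: L2onB; first apply: L2onD.
- exact: L2onZ (ac2_L2 e0' ac2_xtilde).
- apply: (@L2on_ext _ _ _ (fun t => \sum_(s.+1 <= k < N.+1)
     (d k * dx0 (t + (r s - r k)) - a k * x0 (t + (r s - r k))))).
    by move=> t _; apply: eq_bigr => k _; rewrite !addrA.
  apply: L2on_sum => k /andP[sk kN]; have sk' := delay_gap sk kN.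
  have k1 := delay_le1 kN.
  by apply: initial_L2 => //; have := e0; lra.
- apply/L2onZ/L2on_sum => k hk; have := delay_gt_eps hk.
  case/andP: hk => _ /delay_le1 k1 ek.
  apply: initial_L2; [exact: ltW|lra|lra].
Qed.

Let Lph := L2on_phi.
Let e0' : 0 <= eps := ltW e0.

Lemma uhat0E t : uhat0 N r d a y x0 dx0 eps t = u0 t.
Proof. by []. Qed.

(** * Values of [uhat] on the pieces of [0, 1 + eps) *)

Lemma ind1 lo hi (t : R) : lo <= t -> t < hi -> ind lo hi t = 1.
Proof. by rewrite /ind => -> ->. Qed.

Lemma ind_lt lo hi (t : R) : t < lo -> ind lo hi t = 0.
Proof. by rewrite /ind leNgt => ->. Qed.

Lemma ind_ge lo hi (t : R) : hi <= t -> ind lo hi t = 0.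
Proof. by rewrite /ind ltNge => ->; rewrite andbF. Qed.

Lemma uhat_head t : 0 <= t < eps -> uh t = u0 t.
Proof.
move=> /andP[t0 te]; rewrite /uhat ind1// mul1r uhat0E big_nat big1 ?addr0// => s hs.
have es := delay_gt_eps hs; have [s1 sN] := andP hs.
have sp : 0 <= r s.-1 by apply: delay_ge0; rewrite (leq_trans (leq_pred _)).
by rewrite !ind_lt ?mul0r ?addr0//; lra.
Qed.

Lemma uhat_pulse s t : (1 <= s <= N)%N -> 0 <= t < eps -> uh (t + r s) = U s t.
Proof.
move=> hs /andP[t0 te]; have [s1 sN] := andP hs.
have es := delay_gt_eps hs.
rewrite /uhat ind_ge ?mul0r ?add0r; last by lra.
rewrite (@big_nat_only _ _ s)//; last first.
  move=> k /andP[k1 kN] /eqP; rewrite neq_ltn => /orP[ks|sk].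
    have H := delay_gap ks sN.
    by rewrite !ind_ge ?mul0r ?addr0//; lra.
  have H := delay_gap sk kN.
  have H' : r s <= r k.-1 by apply: delay_le; lia.
  by rewrite !ind_lt ?mul0r ?addr0//; lra.
rewrite ind_ge ?mul0r ?add0r; last by lra.
rewrite ind1 ?mul1r; [|lra..].
have te' : 0 <= t <= eps by rewrite t0 ltW.
(* The exponential integral in the definition of [uhat] is the state W. *)
have WE := lq_stateE d cc e0' a_gt0 Lph te'.
by rewrite addrK uhat0E; case: s hs s1 sN es => // s *; rewrite /lq_output WE.
Qed.

Lemma uhat_gap s t : (1 <= s <= N)%N -> r s.-1 + eps <= t < r s ->
  uh t = \sum_(s <= k < N.+1) (d k * dx0 (t - r k) - a k * x0 (t - r k)).
Proof.
move=> hs /andP[t0 te]; have [s1 sN] := andP hs.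
have sp : 0 <= r s.-1 by apply: delay_ge0; rewrite (leq_trans (leq_pred _)).
rewrite /uhat ind_ge ?mul0r ?add0r; last by lra.
rewrite (@big_nat_only _ _ s)//; last first.
  move=> k /andP[k1 kN] /eqP; rewrite neq_ltn => /orP[ks|sk].
    have H : r k <= r s.-1 by apply: delay_le; lia.
    by rewrite !ind_ge ?mul0r ?addr0//; have := e0; lra.
  have H : r s <= r k.-1 by apply: delay_le; lia.
  have H' : r s <= r k by apply: delay_le; lia.
  by rewrite !ind_lt ?mul0r ?addr0//; have := e0; lra.
rewrite [ind (r s) _ _]ind_lt// mul0r addr0 ind1 ?mul1r//.
Qed.

Lemma uhat_output k t : (k <= N)%N -> 0 <= t < eps -> uh (t + r k) = U k t.
Proof.
case: k => [|k] kN te; first by rewrite r0 addr0 uhat_head.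
by rewrite uhat_pulse.
Qed.

Lemma piece_cases n t : (n <= N)%N -> 0 <= t < r n + eps ->
  (exists2 s, (s <= N)%N & r s <= t < r s + eps) \/
  (exists2 s, (1 <= s <= N)%N & r s.-1 + eps <= t < r s).
Proof.
elim: n => [|n IH] nN /andP[t0 tn].
  by left; exists 0%N => //; rewrite r0 t0 -r0.
have [tn'|nt] := ltP t (r n + eps); first by apply: IH; rewrite ?t0// ltnW.
have [tn''|nt'] := ltP t (r n.+1).
  by right; exists n.+1; rewrite ?nN//= nt tn''.
by left; exists n.+1; rewrite ?nN//= nt' tn.
Qed.

(* The trajectory driven by uhat; [dxhat] is its derivative. *)
Definition xhat t := if t < 0 then x0 t else if t < eps then xt t + W t else 0.

Definition dxhat t := if t < 0 then dx0 t else if t < eps then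
  a 0%N * (xt t + W t) + forcing t + u0 t else 0.

Lemma W_end : W eps = - xt eps.
Proof. exact: lq_state_end. Qed.

Lemma ac2_state : ac2 0 eps (fun t => xt t + W t)
  (fun t => a 0%N * (xt t + W t) + forcing t + u0 t).
Proof.
have := ac2D ac2_xtilde (ac2_lq_state d cc e0' a_gt0 Lph).
apply: ac2_ext => // t /andP[t0 te]; have tb : 0 <= t <= eps by rewrite !ltW.
have -> : u0 t = lq_dstate N d a ph cc t - a 0%N * W t by exact: (@lq_controlE _ _ _ _ _ eps).
by ring.
Qed.

(** The three pieces fit together at 0 by the compatibility condition y = x0(0), and at eps because
    the choice of c makes W cancel [xtilde] there. *)
Lemma ac2_xhat : ac2 (-1) T xhat dxhat.
Proof.
have e0'' := e0'.
apply: (@ac2_cat _ _ 0); [lra|lra| |].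
  apply: ac2_ext initial_ac2; [lra| |].
    move=> t /andP[t1 t0]; rewrite /xhat; case: ifPn => //; rewrite -leNgt => t0'.
    have -> : t = 0 by apply: le_anti; rewrite t0.
    by rewrite e0 xtilde0 lq_state0 addr0 yE.
  by move=> t /andP[_ t0]; rewrite /dxhat t0.
apply: (@ac2_cat _ _ eps); [lra|lra| |].
  apply: ac2_ext ac2_state => // t /andP[t0 te].
    rewrite /xhat ltNge t0 /=; case: ifPn => //; rewrite -leNgt => te'.
    have -> : t = eps by apply: le_anti; rewrite te.
    by rewrite W_end subrr.
  by rewrite /dxhat te ltNge (ltW t0).
apply: ac2_ext (ac2_cst eps T 0); [lra| |].
  move=> t /andP[te _]; rewrite /xhat ltNge (le_trans e0')//=.
  by rewrite ltNge te.
move=> t /andP[te _]; rewrite /dxhat ltNge (ltW (lt_trans e0 te))/=.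
by rewrite ltNge (ltW te).
Qed.

Local Notation G k t := (lead d k * dxhat t - a k * xhat t).

Lemma G_ge k t : eps <= t -> G k t = 0.
Proof.
move=> te; rewrite /dxhat /xhat !ltNge te (le_trans e0' te)/=; ring.
Qed.

Lemma G_lt k t : (1 <= k)%N -> t < 0 -> G k t = d k * dx0 t - a k * x0 t.
Proof. by case: k => // k _ t0; rewrite /dxhat /xhat t0. Qed.

Lemma G_mid k t : 0 <= t < eps -> G k t =
  lead d k * (a 0%N * (xt t + W t) + forcing t + u0 t) - a k * (xt t + W t).
Proof. by move=> /andP[t0 te]; rewrite /dxhat /xhat te ltNge t0. Qed.

(** Delays with t - r_k >= eps contribute nothing and those with t - r_k < 0 contribute history. On
    a window exactly one further delay contributes, through the new state; on a gap none does. *)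
Lemma uhat_delay t : 0 <= t < T ->
  uh t = \sum_(0 <= k < N.+1) G k (t - r k).
Proof.
move=> tT.
have [[s sN ts]|[s hs ts]] : (exists2 s, (s <= N)%N & r s <= t < r s + eps) \/
  (exists2 s, (1 <= s <= N)%N & r s.-1 + eps <= t < r s).
- by apply: (@piece_cases N) => //; rewrite rN.
- have [t1 t2] := andP ts.
  have tse : 0 <= t - r s < eps by lra.
  rewrite (big_cat_nat (n := s))//=; last exact: leqW.
  rewrite big_nat big1 ?add0r; last first.
    by move=> k /andP[_ ks]; rewrite G_ge//; have := delay_gap ks sN; lra.
  rewrite big_ltn// G_mid//.
  rewrite (eq_big_nat _ _ (F1 := fun k => G k (t - r k))
    (F2 := fun k => d k * dx0 (t - r k) - a k * x0 (t - r k))); last first.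
    move=> k /andP[sk kN]; rewrite G_lt//; first by rewrite (leq_trans _ sk).
    by have := delay_gap sk kN; lra.
  rewrite -[in LHS](subrK (r s) t) uhat_output//.
  (* For s = 0 the histories of the delays k >= 1 cancel the forcing, leaving the free control
     alone. *)
  case: s sN ts t1 t2 tse => [|s] sN ts t1 t2 tse.
    by rewrite r0 subr0 /lq_output forcingE /lead; ring.
  (* The origin of [phi]: it is everything free of W and of the free control, namely the [xtilde]
     and forcing parts of the s-th delay and the histories of the later delays. *)
  rewrite /lq_output /phi /lead -/(lead d) subrK forcingE.
  by ring.
- have [t1 t2] := andP ts; have [s1 sN] := andP hs.
  rewrite (uhat_gap hs ts) [in RHS](big_cat_nat (n := s))//=; last exact: leqW.
  rewrite [X in _ = X + _](_ : _ = 0) ?add0r; last first.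
    rewrite big_nat big1// => k /andP[_ ks]; rewrite G_ge//.
    have H : r k <= r s.-1 by apply: delay_le; lia.
    by lra.
  apply: eq_big_nat => k /andP[sk kN]; rewrite G_lt//; first by rewrite (leq_trans _ sk).
  have H : r s <= r k by apply: delay_le; lia.
  by lra.
Qed.

Lemma big_lead (x : R -> R) t : \sum_(0 <= k < N.+1) lead d k * x (t - r k) =
  x t + \sum_(1 <= k < N.+1) d k * x (t - r k).
Proof.
rewrite big_ltn// r0 subr0 mul1r; congr (_ + _).
by apply: eq_big_nat => -[].
Qed.

Lemma L2on_delay k (g : R -> R) : (k <= N)%N -> L2on (-1) T g ->
  L2on 0 T (fun t => g (t - r k)).
Proof.
move=> kN /(L2on_shift (- r k)).
have k0 := delay_ge0 kN; have k1 := delay_le1 kN; apply: L2onS; lra.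
Qed.

Lemma ac2_delay k (F f : R -> R) : (k <= N)%N -> ac2 (-1) T F f ->
  ac2 0 T (fun t => F (t - r k)) (fun t => f (t - r k)).
Proof.
move=> kN /(ac2_shift (- r k)).
have := e0; have k0 := delay_ge0 kN; have k1 := delay_le1 kN => ?; apply: ac2_S; lra.
Qed.

Lemma ac2_big_lead (F f : R -> R) : ac2 (-1) T F f ->
  ac2 0 T (fun t => \sum_(0 <= k < N.+1) lead d k * F (t - r k))
          (fun t => \sum_(0 <= k < N.+1) lead d k * f (t - r k)).
Proof.
move=> acF; apply: (ac2_sum (F := fun k t => lead d k * F (t - r k))) => k /andP[_ kN].
exact/ac2Z/ac2_delay.
Qed.

Lemma L2on_big_delay (g : R -> R) : L2on (-1) T g ->
  L2on 0 T (fun t => \sum_(0 <= k < N.+1) a k * g (t - r k)).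
Proof. by move=> Lg; apply: L2on_sum => k /andP[_ kN]; exact/L2onZ/L2on_delay. Qed.

Let mT : -1 <= T. Proof. have := e0; lra. Qed.

Lemma L2on_uhat : L2on 0 T uh.
Proof.
have acX := ac2_xhat; have [Ld _] := acX.
have LX := ac2_L2 mT acX.
have := L2onB (ac2_big_lead acX).1 (L2on_big_delay LX).
apply: L2on_ext => t /andP[t0 tT]; rewrite uhat_delay ?ltW//.
by rewrite -sumrB.
Qed.

Lemma xhat0 : xhat 0 = y.
Proof. by rewrite /xhat ltxx e0 xtilde0 lq_state0 addr0. Qed.

(** [uhat_delay] is the differentiated equation; integrating it by means of the absolute continuity
    of the neutral sum gives the required form. *)
Lemma xhat_solution : is_solution N r d a y x0 uh T xhat.
Proof.
have acX := ac2_xhat.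
split; first exact: ac2_continuous acX.
split; first by move=> t /andP[_ t0]; rewrite /xhat t0.
split; first exact: xhat0.
move=> t tT; have [t0 tT'] := andP tT.
have acL := ac2_big_lead acX.
apply: (etrans (etrans (esym (big_lead xhat t)) (acL.2 t tT))); congr (_ + _).
  apply: (etrans (big_lead xhat 0)); rewrite xhat0; apply: (congr1 (fun w => y + w)).
  by apply: eq_bigr => k _; rewrite sub0r.
apply: integ_ext; last exact: (ac2_L1on tT acL).
move=> s /andP[s0 st]; rewrite uhat_delay; last by rewrite ltW// (lt_le_trans st).
by rewrite -big_split/=; apply: eq_bigr => k _; rewrite addrC subrK.
Qed.

Lemma xhat_ge t : eps <= t -> xhat t = 0.
Proof. by move=> et; rewrite /xhat !ltNge et (le_trans e0' et). Qed.

Lemma uhat_admissible : admissible N r d a y x0 T uh.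
Proof.
split; first exact: L2on_uhat.
exists xhat; split; first exact: xhat_solution.
by move=> t /andP[t1 _]; apply: xhat_ge; lra.
Qed.

(** * Pairing the control with delayed functions *)

Lemma L2on_output k : (k <= N)%N -> L2on 0 eps (U k).
Proof.
have Lu := L2on_lq_control d cc e0' a_gt0 Lph.
case: k => [_|k kN]; first exact: Lu.
apply: L2onD; first apply: L2onD.
- exact: Lph.
- exact: L2onZ.
- apply: L2onZ; exact: ac2_L2 e0' (ac2_lq_state d cc e0' a_gt0 Lph).
Qed.

Lemma integ_support p q p' q' (g : R -> R) : p <= p' -> p' <= q' -> q' <= q ->
  (forall t, p < t < p' -> g t = 0) -> (forall t, q' < t < q -> g t = 0) ->
  L1on p q g -> integ p q g = integ p' q' g.
Proof.
move=> pp pq qq g1 g2 Ig.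
rewrite (integ_cat pp (le_trans pq qq) Ig).
have I2 : L1on p' q g by exact: L1onS Ig.
rewrite (integ_cat pq qq I2).
rewrite (integ_ext (a := p) (g := fun=> 0)) ?integ_cst0//; last first.
  by apply: L1onS Ig => //; rewrite (le_trans pq).
rewrite (integ_ext (a := q') (g := fun=> 0)) ?integ_cst0 ?add0r ?addr0//.
exact: L1onS I2.
Qed.

(** A function supported in [0, eps], delayed by r_k, meets the control only on the k-th window.
    This brings the pairings for all delays back to the same interval [0, eps]. *)
Lemma integ_delay k (h : R -> R) : (k <= N)%N -> L2on (-1) T h ->
  (forall t, -1 < t < 0 -> h t = 0) -> (forall t, eps < t < T -> h t = 0) ->
  integ 0 T (fun t => uh t * h (t - r k)) = integ 0 eps (fun t => U k t * h t).
Proof.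
move=> kN Lh h1 h2; have k0 := delay_ge0 kN; have k1 := delay_le1 kN.
have Ls := L2on_shift (r k) L2on_uhat.
have L1 := L2on_L1onM L2on_uhat (L2on_delay kN Lh).
have L2 : L1on (0 - r k) (T - r k) (fun t => uh (t + r k) * h t).
  by apply: L2on_L1onM Ls _; apply: L2onS Lh; lra.
apply: (etrans (esym (integ_shift (r k) L1))).
apply: (etrans (eq_integ (g := fun t => uh (t + r k) * h t) _)).
  by move=> t _; rewrite addrK.
apply: (etrans (integ_support (p' := 0) (q' := eps) _ _ _ _ _ L2)).
- by lra.
- exact: e0'.
- by lra.
- by move=> t /andP[t1 t0]; rewrite h1 ?mulr0//; lra.
- by move=> t /andP[t1 t0]; rewrite h2 ?mulr0//; lra.
apply: integ_ext; first by move=> t /andP[t0 te]; rewrite uhat_output// ltW.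
by apply: L1onS L2; have := e0; lra.
Qed.

(** * Comparison with an arbitrary admissible control *)

Section Competitor.
Variables (u x : R -> R).
Hypothesis Lu : L2on 0 T u.
Hypothesis solx : is_solution N r d a y x0 u T x.
Hypothesis x_end : forall t, T - 1 <= t <= T -> x t = 0.

Local Notation v := (fun t => u t - uh t).
Definition zdiff t := x t - xhat t.
Definition dzdiff t := if (0 <= t) && (t < eps) then a 0%N * zdiff t + v t else 0.
Local Notation z := zdiff.
Local Notation dz := dzdiff.

Let Lv : L2on 0 T v.
Proof. exact: L2onB Lu L2on_uhat. Qed.

Let Lx : L2on (-1) T x.
Proof. by case: solx => cx _; exact: L2on_continuous. Qed.

Let Lxhat : L2on (-1) T xhat.
Proof. exact: ac2_L2 mT ac2_xhat. Qed.

Let Lz : L2on (-1) T z.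
Proof. exact: L2onB. Qed.

Lemma zdiff_le0 t : -1 <= t <= 0 -> z t = 0.
Proof.
move=> /andP[t1]; rewrite le_eqVlt /z; case: solx => _ [xl [xy _]] /predU1P[->|t0].
  by rewrite xy xhat0 subrr.
by rewrite xl ?t1// /xhat t0 subrr.
Qed.

Lemma zdiff_ge t : eps <= t <= T -> z t = 0.
Proof.
move=> /andP[te tT]; rewrite /z xhat_ge// x_end ?subrr//; rewrite tT andbT; lra.
Qed.

Lemma zdiff_eq t : 0 <= t <= T -> \sum_(0 <= k < N.+1) lead d k * z (t - r k) =
  integ 0 t (fun s => \sum_(0 <= k < N.+1) a k * z (s - r k) + v s).
Proof.
move=> tT; have [t0 tT'] := andP tT.
have [_ [xl [xy xe]]] := solx.
have [_ [hl [hy he]]] := xhat_solution.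
have IL (h w : R -> R) : L2on (-1) T h -> L2on 0 T w ->
    L1on 0 t (fun s => \sum_(0 <= k < N.+1) a k * h (s - r k) + w s).
  move=> Lh Lw; apply: (L1onS (lexx 0) tT'); apply: L2on_L1on; apply: L2onD => //.
  exact: L2on_big_delay.
have E : \sum_(0 <= k < N.+1) lead d k * z (t - r k) =
  \sum_(0 <= k < N.+1) lead d k * x (t - r k) - \sum_(0 <= k < N.+1) lead d k * xhat (t - r k).
  by rewrite -sumrB; apply: eq_bigr => k _; rewrite /zdiff mulrBr.
apply: (etrans E).
rewrite (big_lead x) (big_lead xhat) xe// he//.
have -> : \sum_(1 <= k < N.+1) d k * xhat (- r k) = \sum_(1 <= k < N.+1) d k * x (- r k).
  apply: eq_big_nat => k hk; have rk := delay_gt_eps hk.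
  case/andP: hk => _ /delay_le1 rk1.
  have e0c := e0; have rk0 : -1 <= - r k < 0 by lra.
  by rewrite hl ?xl.
rewrite opprD addrACA subrr add0r -integB; [|exact: IL Lx Lu|exact: IL Lxhat L2on_uhat].
apply: eq_integ => s _; rewrite opprD addrACA; congr (_ + _).
by rewrite -sumrB; apply: eq_bigr => k _; rewrite /zdiff mulrBr.
Qed.

(** The arguments s - r_k with k >= 1 lie in [-1, 0], where the two trajectories agree, so the
    neutral equation reduces to z' = a_0 z + v. This supplies an L^2 derivative although the
    competitor was only assumed continuous. *)
Lemma zdiff_head t : 0 <= t <= eps -> z t = integ 0 t (fun s => a 0%N * z s + v s).
Proof.
move=> /andP[t0 te].
have tT : 0 <= t <= T by rewrite t0/= (le_trans te)//; have := e0; lra.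
have z0 k s : (1 <= k < N.+1)%N -> 0 <= s <= t -> z (s - r k) = 0.
  move=> hk /andP[s0 st]; have rk := delay_gt_eps hk; case/andP: hk => _ /delay_le1 rk1.
  by apply: zdiff_le0; lra.
have S0 : \sum_(1 <= k < N.+1) d k * z (t - r k) = 0.
  by rewrite big_nat big1// => k hk; rewrite z0 ?mulr0// t0 lexx.
have E : z t = \sum_(0 <= k < N.+1) lead d k * z (t - r k).
  by apply/esym/(etrans (big_lead z t)); rewrite S0 addr0.
apply: (etrans E); apply: (etrans (zdiff_eq tT)).
apply: eq_integ => s st; congr (_ + _).
rewrite big_ltn// r0 subr0 big_nat big1 ?addr0// => k hk.
by rewrite z0 ?mulr0.
Qed.

Lemma ac2_zdiff : ac2 (-1) T z dz.
Proof.
have e0'' := e0'.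
apply: (@ac2_cat _ _ 0); [lra|lra| |].
  apply: ac2_ext (ac2_cst (-1) 0 0); [lra| |].
    by move=> t tl; rewrite zdiff_le0.
  by move=> t /andP[_ t0]; rewrite /dzdiff leNgt t0.
apply: (@ac2_cat _ _ eps); [lra|lra| |].
  have H : ac2 0 eps z (fun s => a 0%N * z s + v s).
    split; last by move=> t te; rewrite zdiff_head// zdiff_le0 ?add0r//; lra.
    apply: L2onD; last by apply: L2onS Lv; lra.
    by apply/L2onZ; apply: L2onS Lz; lra.
  apply: ac2_ext H => // t /andP[t0 te].
  by rewrite /dzdiff te ltW.
apply: ac2_ext (ac2_cst eps T 0); [lra| |].
  by move=> t tl; rewrite zdiff_ge.
by move=> t /andP[te _]; rewrite /dzdiff [t < _]ltNge (ltW te) andbF.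
Qed.

Let Ldz : L2on (-1) T dz.
Proof. by case: ac2_zdiff. Qed.

(** The equation is known only in integrated form: both sides have equal integrals over every
    [0, t], hence agree almost everywhere. *)
Lemma control_diff_ae : {ae mu, forall t, 0 <= t <= T ->
  v t = \sum_(0 <= k < N.+1) (lead d k * dz (t - r k) - a k * z (t - r k))}.
Proof.
have acL := ac2_big_lead ac2_zdiff; have [LL _] := acL.
have La := L2on_big_delay Lz.
pose h t := v t - (\sum_(0 <= k < N.+1) lead d k * dz (t - r k) -
                   \sum_(0 <= k < N.+1) a k * z (t - r k)).
have Lh : L2on 0 T h by exact: L2onB Lv (L2onB LL La).
have alg (i1 i2 i3 i4 : R) : i4 = 0 -> i4 + i2 = i3 + i1 -> i1 - (i2 - i3) = 0 by lra.
have z0 k : (k <= N)%N -> z (0 - r k) = 0.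
  by move=> kN; apply: zdiff_le0; have := delay_ge0 kN; have := delay_le1 kN; lra.
have Z0 : \sum_(0 <= k < N.+1) lead d k * z (0 - r k) = 0.
  by rewrite big_nat big1// => k /andP[_ kN]; rewrite z0 ?mulr0.
have h0 t : 0 <= t <= T -> integ 0 t h = 0.
  move=> tT; have [t0 tT'] := andP tT.
  have S (g : R -> R) : L2on 0 T g -> L1on 0 t g.
    by move=> Lg; apply: (L1onS (lexx 0) tT'); exact: L2on_L1on.
  have E1 := integB (S _ Lv) (S _ (L2onB LL La)).
  have E2 := integB (S _ LL) (S _ La).
  have E3 := acL.2 t tT.
  have E4 := etrans (zdiff_eq tT) (integD (S _ La) (S _ Lv)).
  apply: (etrans (etrans E1 (congr1 (fun w => integ 0 t v - w) E2))).
  exact: (alg _ _ _ _ Z0 (etrans (esym E3) E4)).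
have := ae_eq0_of_integ0 (L2on_L1on Lh) h0.
apply: filterS; first exact: (ae_filter_ringOfSetsType mu).
move=> t ht /ht /eqP; rewrite subr_eq0 => /eqP ->.
by rewrite -sumrB.
Qed.

(** Expanding v by delays and shifting each term gives the integral over [0, eps] of sum U_k (lead_k
    z' - a_k z). By the Euler-Lagrange equation this integrand is the derivative of z times the
    momentum, and z vanishes at both ends. *)
Lemma uhat_orthogonal : integ 0 T (fun t => uh t * v t) = 0.
Proof.
pose h k t := lead d k * dz t - a k * z t.
have Lh k : L2on (-1) T (h k) by exact: L2onB (L2onZ _ Ldz) (L2onZ _ Lz).
have LV k : (k <= N)%N -> L2on 0 T (fun t => h k (t - r k)).
  by move=> kN; exact: L2on_delay kN (Lh k).
have LV' : L2on 0 T (fun t => \sum_(0 <= k < N.+1) h k (t - r k)).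
  by apply: L2on_sum => k /andP[_ kN]; exact: LV.
have h1 k t : -1 < t < 0 -> h k t = 0.
  move=> /andP[t1 t0]; rewrite /h /dzdiff [0 <= t]leNgt t0/= zdiff_le0 ?mulr0 ?subr0//.
  by rewrite !ltW.
have h2 k t : eps < t < T -> h k t = 0.
  move=> /andP[te tT]; rewrite /h /dzdiff [t < eps]ltNge (ltW te) andbF zdiff_ge ?mulr0 ?subr0//.
  by rewrite !ltW.
have Sh k : L2on 0 eps (h k) by apply: L2onS (Lh k); have := e0; lra.
have acz : ac2 0 eps z dz by apply: ac2_S ac2_zdiff; have := e0; lra.
have EL := lq_euler_lagrange d cc e0' a_gt0 Lph.
apply: (etrans (integ_ae_eq (L2on_L1onM L2on_uhat Lv) (L2on_L1onM L2on_uhat LV') _)).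
  move: control_diff_ae; apply: filterS; first exact: (ae_filter_ringOfSetsType mu).
  by move=> t ht /ht ->.
apply: (etrans (eq_integ (g := fun t => \sum_(0 <= k < N.+1) uh t * h k (t - r k)) _)).
  by move=> t _; rewrite mulr_sumr.
apply: (etrans (integ_sum (f := fun k t => uh t * h k (t - r k)) _)).
  by move=> k /andP[_ kN]; exact: L2on_L1onM L2on_uhat (LV k kN).
apply: (etrans (eq_big_nat _ _ (F2 := fun k => integ 0 eps (fun t => U k t * h k t)) _)).
  by move=> k /andP[_ kN]; exact: integ_delay kN (Lh k) (h1 k) (h2 k).
apply: (etrans (esym (integ_sum (f := fun k t => U k t * h k t) _))).
  by move=> k /andP[_ kN]; exact: L2on_L1onM (L2on_output kN) (Sh k).
have alg (i z1 z2 p1 p2 : R) : z1 = 0 -> z2 = 0 -> z1 * p1 = z2 * p2 + i -> i = 0.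
  by move=> -> ->; rewrite !mul0r add0r.
have ee : 0 <= eps <= eps by rewrite e0' lexx.
have z_eps : z eps = 0 by apply: zdiff_ge; have := e0; lra.
have z_0 : z 0 = 0 by apply: zdiff_le0; lra.
(* The product rule, read at t = eps, equates the two vanishing boundary products up to the
   integral. *)
apply: (etrans _ (alg _ _ _ _ _ z_eps z_0 ((ac2M e0' acz EL).2 eps ee))).
apply: eq_integ => t _; rewrite mulrN !mulr_sumr -sumrB; apply: eq_bigr => k _.
by rewrite /h; ring.
Qed.

Lemma integ_sqr_split : integ 0 T (fun t => u t ^+ 2) =
  integ 0 T (fun t => uh t ^+ 2) + integ 0 T (fun t => v t ^+ 2).
Proof.
have Luh := L2on_uhat.
have [_ I1] := (L2onP _ _ _).1 Luh; have [_ I2] := (L2onP _ _ _).1 Lv.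
have I3 := L2on_L1onM Luh Lv.
apply: (etrans (eq_integ (g := fun t => uh t ^+ 2 + 2 * (uh t * v t) + v t ^+ 2) _)).
  by move=> t _; ring.
apply: (etrans (integD (L1onD I1 (L1onZ 2 I3)) I2)).
apply: (etrans (congr1 (fun w => w + _) (integD I1 (L1onZ 2 I3)))).
by rewrite (integZ 2 I3) uhat_orthogonal mulr0 addr0.
Qed.

End Competitor.

End DelaySystem.

Theorem mainTheorem6 (R : realType) (N : nat) (r d a : nat -> R)
  (y : R) (x0 dx0 : R -> R) (eps : R) :
  (1 <= N)%N ->
  r 0%N = 0 -> r N = 1 ->
  (forall s, (1 <= s <= N)%N -> r s.-1 < r s) ->
  d N ^+ 2 + a N ^+ 2 != 0 ->
  W12 x0 dx0 -> y = x0 0 ->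
  0 < \sum_(0 <= k < N.+1) a k ^+ 2 ->
  0 < eps -> (forall s, (1 <= s <= N)%N -> eps < r s - r s.-1) ->
  let T := 1 + eps in
  let uh := uhat N r d a y x0 dx0 eps in
  0 < ahat N d a /\
  admissible N r d a y x0 T uh /\
  (forall u, admissible N r d a y x0 T u -> L2norm 0 T uh <= L2norm 0 T u) /\
  (forall u, admissible N r d a y x0 T u -> L2norm 0 T u <= L2norm 0 T uh ->
     {ae @lebesgue_measure R, forall t, 0 <= t <= T -> u t = uh t}).

Proof.
move=> N1 r0 rN _ _ Wx yE a_gt0 e0 gap T uh.
have Luh : L2on 0 T uh by exact: L2on_uhat.
have Lsq (f : R -> R) : 0 <= integ 0 T (fun t => f t ^+ 2).
  by apply: Rintegral_ge0 => t _; exact: sqr_ge0.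
have pythagoras u : admissible N r d a y x0 T u -> L2on 0 T u /\
    integ 0 T (fun t => u t ^+ 2) =
    integ 0 T (fun t => uh t ^+ 2) + integ 0 T (fun t => (u t - uh t) ^+ 2).
  move=> [Lu [x [solx xT]]]; split=> //.
  exact: integ_sqr_split solx xT.
split; first exact: ahat_gt0.
split; first exact: uhat_admissible.
split=> u /pythagoras[Lu E]; rewrite /L2norm E.
  by rewrite ler_wsqrtr// lerDl.
(* Under the Pythagorean identity, a norm no larger than that of [uh] forces the squared distance to
   be at most zero. *)
rewrite ler_sqrt// gerDl => v0.
have := integ_sqr_eq0 (L2onB Lu Luh) v0.
apply: filterS; first exact: (ae_filter_ringOfSetsType (@lebesgue_measure R)).
by move=> t ht /ht /eqP; rewrite subr_eq0 => /eqP.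
Qed.
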